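(* Let $q$ be a power of $2$, let $m=4t+2\ge 2$ for an integer $t\ge 0$, and let $n=q^{m}+1$. Then: (1) For every integer $\delta$ with $\delta_{2,n}+1\le\delta\le\delta_{1,n}$, the code $\mathcal{C}_{(n,q,\delta,1)}$ is an LCD code with parameters $[n,5,d\ge\delta_{2,n}]$; for every integer $\delta$ with $\delta_{3,n}+1\le\delta\le\delta_{2,n}$, $\mathcal{C}_{(n,q,\delta,1)}$ is an LCD code with parameters $[n,2m+5,d\ge\delta_{3,n}]$. (2) For every integer $\delta$ with $\delta_{2,n}+1\le\delta\le\delta_{1,n}$, the code $\mathcal{C}_{(n,q,\delta+1,0)}$ is an LCD code with parameters $[n,4,d\ge 2\delta_{2,n}]$; for every integer $\delta$ with $\delta_{3,n}+1\le\delta\le\delta_{2,n}$, $\mathcal{C}_{(n,q,\delta+1,0)}$ is an LCD code with parameters $[n,2m+4,d\ge 2\delta_{3,n}]$.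
   Context: Let $q$ be a prime power and $n\ge2$ an integer with $\gcd(n,q)=1$. Let $\ell=\mathrm{ord}_n(q)$, let $\alpha$ be a generator of $\mathbb{F}_{q^\ell}^*$, $\beta=\alpha^{(q^\ell-1)/n}$, and let $m_i(x)$ be the minimal polynomial of $\beta^i$ over $\mathbb{F}_q$. For integers $b\ge0$ and $2\le\delta\le n$, $\mathcal{C}_{(n,q,\delta,b)}$ denotes the cyclic code of length $n$ over $\mathbb{F}_q$ with generator polynomial $\mathrm{lcm}(m_b(x),m_{b+1}(x),\dots,m_{b+\delta-2}(x))$. A linear code $\mathcal{C}$ is LCD if $\mathcal{C}\cap\mathcal{C}^{\perp}=\{0\}$ ($\perp$ the Euclidean dual). The notation $[n,k,d\ge D]$ means length $n$, dimension $k$, and minimum Hamming distance at least $D$. For $0\le s\le n-1$, the $q$-cyclotomic coset of $s$ modulo $n$ is $C_s=\{sq^i \bmod n:0\le i\le \ell-1\}$; its least element is its coset leader; $\mathrm{MinRep}_n$ is the set of all coset leaders modulo $n$ (including $0$), and $\delta_{i,n}$ denotes the $i$-th largest element of $\mathrm{MinRep}_n$. *)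

(* Defs.v *)
From HB Require Import structures.
From mathcomp Require Import all_boot all_order all_algebra all_field.
Set Implicit Arguments. Unset Strict Implicit. Unset Printing Implicit Defensive.
Import GRing.Theory.
Local Open Scope ring_scope.

(* Multiplicative order of q modulo n (for gcd(n,q)=1 it is <= n):
   the least j >= 1 with q^j = 1 mod n. *)
Definition ord_mod (n q : nat) : nat :=
  (find (fun j => q ^ j.+1 %% n == 1)%N (iota 0 n)).+1.

Definition cyc_coset (n q s : nat) : seq nat :=
  [seq (s * q ^ i %% n)%N | i <- iota 0 (ord_mod n q)].

Definition is_coset_leader (n q s : nat) : bool :=
  (s < n)%N && all (fun x => s <= x)%N (cyc_coset n q s).

Definition MinRep (n q : nat) : seq nat :=
  sort geq [seq s <- iota 0 n | is_coset_leader n q s].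

(* delta_{i,n} : the i-th largest coset leader (i >= 1); 0 if it does not exist *)
Definition delta_i (n q i : nat) : nat := nth 0%N (MinRep n q) i.-1.

Definition lcmp (K : fieldType) (p r : {poly K}) : {poly K} := (p * r) %/ gcdp p r.

Section Codes.
Variables (F : finFieldType) (L : fieldExtType F).

Definition BCH_genpoly (beta : L) (delta b : nat) : {poly L} :=
  \big[@lcmp L/1]_(b <= i < b + delta.-1) minPoly 1%AS (beta ^+ i).

Definition poly_of_word (n : nat) (c : 'rV[F]_n) : {poly L} :=
  map_poly (in_alg L) (rVpoly c).

Definition BCH_code (n : nat) (beta : L) (delta b : nat) : {set 'rV[F]_n} :=
  [set c | BCH_genpoly beta delta b %| poly_of_word c].

End Codes.

Definition dual_code (F : finFieldType) (n : nat) (C : {set 'rV[F]_n}) : {set 'rV[F]_n} :=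
  [set u | [forall c in C, (u *m c^T) == 0]].

Definition is_LCD (F : finFieldType) (n : nat) (C : {set 'rV[F]_n}) : Prop :=
  C :&: dual_code C = [set 0].

Definition code_dim (F : finFieldType) (n : nat) (C : {set 'rV[F]_n}) : nat :=
  \dim (span (enum C)).

Definition wt (F : finFieldType) (n : nat) (c : 'rV[F]_n) : nat :=
  #|[set i | c 0 i != 0]|.

Definition has_params (F : finFieldType) (n : nat) (C : {set 'rV[F]_n}) (k D : nat) : Prop :=
  code_dim C = k /\ (forall c, c \in C -> c != 0 -> (D <= wt c)%N).

(* Main.v *)
Require Import Defs.
From HB Require Import structures.
From mathcomp Require Import all_boot all_order all_algebra all_field.
From mathcomp Require Import zify ring.
Set Implicit Arguments. Unset Strict Implicit. Unset Printing Implicit Defensive.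
Import Order.TTheory GRing.Theory Num.Theory.

(** A word [c] lies in the code iff its polynomial vanishes at [beta ^ i] for the
    [i] in the defining range; since [q ^ m = -1] modulo [n], the zeros come in
    pairs [i, -i].

    Dimension: it is the number of exponents whose coset leader lies outside the
    range, so everything reduces to the sizes of the cosets of [delta_1] and
    [delta_2].  LCD: if [c] is in the code and its dual, the reversed shifts
    [i |-> c_(k - i)] are codewords as well, so [c(x) ^ 2 = 0] modulo [x ^ n - 1].
    Distance: the BCH bound, applied in the case [b = 0] to the symmetric range
    of exponents.

    Coset leaders: write [q = 2h], and [w = n - 2s] for a residue [s].  In terms
    of [w], multiplication of [s] by [q] is the expanding map [w |-> q w -+ n], and
    the leader of a coset is large when the orbit of [w] stays close to [0].  With
    [N = n / (q^2 + 1)], the best orbit is [A, B, -A, -B] for [A = (q + 1) N] and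
    [B = (q - 1) N]; it is the coset of size 4, and [delta_1 = h (q - 1) N].  An
    orbit confined only slightly less must visit times where [w] does not change
    sign; following [|w| - A] along these times, a parity argument ([m / 2] is odd)
    shows that it is the best orbit.  The threshold is sharp: for [m > 2] it gives
    [delta_2 = h (q - 1) (N - 2 P)] with [P = (q^(m-4) + 1) / (q^2 + 1)], whose
    coset has size [2m] because [delta_2] is coprime to [N].  For [m = 2] every
    nonzero coset has size [4 = 2m]. *)

(** * Words, zeros and the BCH code *)

Local Open Scope ring_scope.

(** After division by the gcd the cofactors are coprime, so Gauss's lemma applies; [p != 0] keeps
    the gcd nonzero. *)
Lemma dvdp_lcmp (K : fieldType) (p r s : {poly K}) :
  p != 0 -> (lcmp p r %| s) = (p %| s) && (r %| s).
Proof.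
move=> p0; have g0 : gcdp p r != 0 by rewrite gcdp_eq0 negb_and p0.
have -> : lcmp p r = p * (r %/ gcdp p r) by rewrite /lcmp divp_mulA ?dvdp_gcdr.
have cop : coprimep (p %/ gcdp p r) (r %/ gcdp p r).
  by apply: coprimep_div_gcd; rewrite p0.
have Ep : p = p %/ gcdp p r * gcdp p r by rewrite divpK ?dvdp_gcdl.
have Er : r = r %/ gcdp p r * gcdp p r by rewrite divpK ?dvdp_gcdr.
apply/idP/andP => [h|[hp hr]].
  split; first by apply: dvdp_trans h; rewrite dvdp_mulr.
  apply: dvdp_trans h; have -> : p * (r %/ gcdp p r) = p %/ gcdp p r * r.
    by rewrite {1}Ep mulrAC -mulrA -Er.
  by rewrite dvdp_mull.
have /dvdpP [u Eu] : gcdp p r %| s by apply: dvdp_trans hp; rewrite dvdp_gcdl.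
move: hp hr; rewrite {1}Ep {3}Er Eu !dvdp_mul2r // => hp hr.
by rewrite {1}Ep mulrAC dvdp_mul2r // Gauss_dvdp // hp hr.
Qed.

Lemma card_pnat_pchar (F : finFieldType) (L : fieldExtType F) :
  [pchar L].-nat #|F|.
Proof.
have [p pp cF] := finPcharP F.
have cL : p \in [pchar L] by rewrite pchar_lalg.
by rewrite (eq_pnat _ (pcharf_eq cL)) (card_pprimeChar cF) pnatX pnat_id // orbT.
Qed.

Lemma frobeniusD (F : finFieldType) (L : fieldExtType F) (x y : L) :
  (x + y) ^+ #|F| = x ^+ #|F| + y ^+ #|F|.
Proof. by rewrite exprDn_pchar // card_pnat_pchar. Qed.

Lemma frobeniusN (F : finFieldType) (L : fieldExtType F) (x : L) :
  (- x) ^+ #|F| = - x ^+ #|F|.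
Proof.
have q0 : (0 < #|F|)%N by apply/card_gt0P; exists 0.
apply/eqP; rewrite -subr_eq0 opprK -frobeniusD addNr expr0n.
by rewrite eqn0Ngt q0.
Qed.

Lemma frobenius_sum (F : finFieldType) (L : fieldExtType F) I (r : seq I) (f : I -> L) :
  (\sum_(i <- r) f i) ^+ #|F| = \sum_(i <- r) f i ^+ #|F|.
Proof.
elim: r => [|i r IH]; last by rewrite !big_cons frobeniusD IH.
have q0 : (0 < #|F|)%N by apply/card_gt0P; exists 0.
by rewrite !big_nil expr0n eqn0Ngt q0.
Qed.

Lemma word_horner (F : finFieldType) (L : fieldExtType F) n (c : 'rV[F]_n) (x : L) :
  (poly_of_word L c).[x] = \sum_(i < n) (c 0 i)%:A * x ^+ i.
Proof.
rewrite (horner_coef_wide (n := n)); last first.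
  by rewrite size_map_poly /rVpoly size_poly.
apply: eq_bigr => i _; rewrite coef_map /= coef_rVpoly_ord //.
Qed.

(** The coefficients of a word lie in [F], hence are fixed by the [#|F|]-power map. *)
Lemma word_horner_frobenius (F : finFieldType) (L : fieldExtType F) n (c : 'rV[F]_n) (x : L) :
  (poly_of_word L c).[x ^+ #|F|] = (poly_of_word L c).[x] ^+ #|F|.
Proof.
rewrite !word_horner frobenius_sum; apply: eq_bigr => i _.
by rewrite exprMn -!exprM mulnC -in_algE -rmorphXn /= expf_card.
Qed.

Lemma word_horner_frobeniusX (F : finFieldType) (L : fieldExtType F) n (c : 'rV[F]_n) (x : L) k :
  (poly_of_word L c).[x ^+ (#|F| ^ k)] = (poly_of_word L c).[x] ^+ (#|F| ^ k).
Proof.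
elim: k => [|k IH]; first by rewrite expn0 !expr1.
by rewrite expnSr !exprM word_horner_frobenius IH.
Qed.

Lemma poly_of_word_over (F : finFieldType) (L : fieldExtType F) n (c : 'rV[F]_n) :
  poly_of_word L c \is a polyOver 1%AS.
Proof. by apply/polyOver1P; exists (rVpoly c). Qed.

Lemma in_BCH_code (F : finFieldType) (L : fieldExtType F) n (beta : L) delta b (c : 'rV[F]_n) :
  reflect (forall i, (b <= i < b + delta.-1)%N -> (poly_of_word L c).[beta ^+ i] = 0)
    (c \in BCH_code n beta delta b).
Proof.
rewrite inE /BCH_genpoly.
have minP x : (minPoly 1%AS x %| poly_of_word L c) = root (poly_of_word L c) x.
  apply/idP/idP => [h|]; last exact/minPoly_dvdp/poly_of_word_over.
  by rewrite -dvdp_XsubCl; apply: dvdp_trans h; rewrite dvdp_XsubCl root_minPoly.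
have -> : (\big[@lcmp L/1]_(b <= i < b + delta.-1) minPoly 1%AS (beta ^+ i)
   %| poly_of_word L c) = all (fun i => root (poly_of_word L c) (beta ^+ i))
     (index_iota b (b + delta.-1)).
  elim: (index_iota _ _) => [|i r IH]; first by rewrite big_nil dvd1p.
  by rewrite big_cons dvdp_lcmp ?monic_neq0 ?monic_minPoly // IH minP.
apply: (iffP allP) => h i; last by rewrite mem_index_iota => /h /eqP.
by rewrite -mem_index_iota => /h /eqP.
Qed.

(** Instead of a Vandermonde determinant, an auxiliary polynomial [p] vanishing at all support
    positions but one isolates a nonzero coordinate. *)
Lemma BCH_bound (F : finFieldType) (L : fieldExtType F) n (beta : L) a w (c : 'rV[F]_n) :
  n.-primitive_root beta -> c != 0 ->
  (forall l, (l < w)%N -> (poly_of_word L c).[beta ^+ (a + l)] = 0) -> (w < wt c)%N.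
Proof.
move=> prim cn0 hz; rewrite ltnNge; apply/negP => wtw.
have [i0 ci0] : exists i0, c 0 i0 != 0.
  apply/existsP; rewrite -negb_forall; apply: contra cn0 => /forallP h.
  by apply/eqP/rowP => i; rewrite mxE; apply/eqP.
pose S := [set i | c 0 i != 0] :\ i0.
pose p : {poly L} := \prod_(z <- [seq beta ^+ val i | i <- enum S]) ('X - z%:P).
(* One support position is left out, so [p] has at most [w] coefficients, one for each known zero of
   the word. *)
have sp : (size p <= w)%N.
  rewrite size_prod_XsubC size_map -cardE; apply: leq_trans wtw.
  have i0S : i0 \in [set i | c 0 i != 0] by rewrite inE.
  by rewrite /wt (cardsD1 i0 [set i | c 0 i != 0]) i0S.
(* Expanding [p] gives a combination of the vanishing values at [beta ^+ (a + l)]; computed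
   directly, only the term of [i0] survives. *)
have : \sum_(i < n) (c 0 i)%:A * beta ^+ (i * a) * p.[beta ^+ i] = 0.
  under eq_bigr => i _ do rewrite (horner_coef_wide _ sp) mulr_sumr.
  rewrite exchange_big big1 //= => l _.
  transitivity (p`_l * (poly_of_word L c).[beta ^+ (a + l)]).
    rewrite word_horner mulr_sumr; apply: eq_bigr => i _.
    rewrite -!exprM [(_ * i)%N]mulnC mulnDr exprD; ring.
  by rewrite hz ?mulr0.
rewrite (bigD1 i0) //= big1 ?addr0 => [/eqP|i ii0].
  rewrite !mulf_eq0 scaler_eq0 oner_eq0 (negbTE ci0) expf_eq0 (prim_root_eq0 prim).
  have n0 : (0 < n)%N by apply: leq_ltn_trans (ltn_ord i0).
  rewrite -[n == 0%N]negbK -lt0n n0 andbF /= => /eqP/rootP.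
  rewrite root_prod_XsubC => /mapP [i]; rewrite mem_enum !inE => /andP [ii0 _].
  move=> /eqP; rewrite (eq_prim_root_expr prim) !(modn_small (ltn_ord _)).
  by move=> /eqP /val_inj /esym /eqP; rewrite (negbTE ii0).
have [ci|ci] := eqVneq (c 0 i) 0; first by rewrite ci scale0r !mul0r.
have /rootP -> : root p (beta ^+ i); last by rewrite mulr0.
rewrite root_prod_XsubC; apply: (map_f (fun i : 'I_n => beta ^+ i)).
by rewrite mem_enum !inE ii0.
Qed.

Lemma BCH_LCD (F : finFieldType) (L : fieldExtType F) n (beta : L) m delta b :
  n.-primitive_root beta -> (n %| #|F| ^ m + 1)%N ->
  is_LCD (BCH_code n beta delta b).
Proof.
case: n => [|n'] prim hm; first by have := prim_order_gt0 prim.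
apply/setP => c; rewrite !inE; apply/andP/eqP => [[]|->]; last first.
  split; first by rewrite /poly_of_word !raddf0 dvdp0.
  by apply/'forall_implyP => u _; rewrite mul0mx.
rewrite -/(BCH_genpoly beta delta b) => hc /'forall_implyP hd.
have {hc} hc : c \in BCH_code n'.+1 beta delta b by rewrite inE.
(* Raising to the power [#|F| ^ m] inverts every power of [beta]. *)
have hinv i : beta ^+ i * (beta ^+ i) ^+ (#|F| ^ m) = 1.
  rewrite -exprS -addn1 exprAC; move: hm.
  by rewrite (prim_order_dvd prim) => /eqP ->; rewrite expr1n.
have hadd (i : nat) (k l : 'I_n'.+1) :
    (beta ^+ i) ^+ (k + l)%R = (beta ^+ i) ^+ k * (beta ^+ i) ^+ l.
  rewrite -exprD ![(beta ^+ i) ^+ _]exprAC; congr (_ ^+ _).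
  by rewrite /= prim_expr_mod.
have hmod (i : nat) (k l : 'I_n'.+1) :
    (beta ^+ i) ^+ (k - l)%R = (beta ^+ i) ^+ k * ((beta ^+ i) ^+ (#|F| ^ m)) ^+ l.
  have -> : (beta ^+ i) ^+ k = (beta ^+ i) ^+ (k - l)%R * (beta ^+ i) ^+ l.
    by rewrite -hadd subrK.
  by rewrite -mulrA -exprMn hinv expr1n mulr1.
(* At a zero [x] of [c], the reversed shift has value [x^k c(1/x) = x^k c(x)^(q^m) = 0], so it is a
   codeword; its product with [c] is the coefficient of index [k] in [c(x)^2] modulo [x^n - 1]. *)
have conv (k : 'I_n'.+1) : \sum_i c 0 i * c 0 (k - i) = 0.
  have /hd : (\row_i c 0 (k - i)) \in BCH_code n'.+1 beta delta b.
    apply/in_BCH_code => i hi; rewrite word_horner.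
    rewrite (reindex_inj (inv_inj (subKr k))) /=.
    under eq_bigr => l _ do rewrite mxE subKr hmod mulrCA.
    rewrite -mulr_sumr -word_horner word_horner_frobeniusX.
    have/in_BCH_code/(_ _ hi) -> := hc.
    by rewrite expr0n expn_eq0 -[_ == 0%N]negbK -lt0n (leq_trans _ (finNzRing_gt1 _)) // mulr0.
  move/eqP/matrixP/(_ 0 0); rewrite !mxE => h; rewrite -[RHS]h.
  by apply: eq_bigr => i _; rewrite !mxE.
have ev0 i : (poly_of_word L c).[beta ^+ i] = 0.
  apply/eqP; rewrite -sqrf_eq0 expr2 {1}word_horner mulr_suml.
  apply/eqP; transitivity (\sum_(s < n'.+1) (beta ^+ i) ^+ s *
      (\sum_k c 0 k * c 0 (s - k))%:A); last first.
    by rewrite big1 // => s _; rewrite conv scale0r mulr0.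
  under [RHS]eq_bigr => s _ do rewrite -in_algE rmorph_sum /= mulr_sumr.
  rewrite [RHS]exchange_big /=; apply: eq_bigr => k _.
  rewrite word_horner (reindex_inj (addIr (- k))) mulr_sumr /=.
  apply: eq_bigr => s _.
  have -> : (beta ^+ i) ^+ s = (beta ^+ i) ^+ (s - k)%R * (beta ^+ i) ^+ k.
    by rewrite -hadd subrK.
  have -> : (c 0 k * c 0 (s - k))%:A = (c 0 k)%:A * (c 0 (s - k))%:A :> L.
    by rewrite -!in_algE rmorphM.
  ring.
(* A nonzero word vanishing at all powers of [beta] would have weight greater than its length. *)
apply/eqP; apply: contraT => cn0.
have := @BCH_bound _ _ _ _ 0 n'.+1 _ prim cn0 (fun l _ => ev0 _).
by rewrite ltnNge (leq_trans (max_card _)) // card_ord.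
Qed.

(** * Dimension of the code from its set of zeros *)

Definition frobenius (F : finFieldType) (L : fieldExtType F) (x : L) : L := x ^+ #|F|.

Lemma frobeniusB (F : finFieldType) (L : fieldExtType F) : zmod_morphism (@frobenius F L).
Proof. by move=> x y; rewrite /frobenius frobeniusD frobeniusN. Qed.

Lemma frobeniusM (F : finFieldType) (L : fieldExtType F) : monoid_morphism (@frobenius F L).
Proof. by split=> [|x y]; rewrite /frobenius (expr1n, exprMn). Qed.

HB.instance Definition _ (F : finFieldType) (L : fieldExtType F) :=
  GRing.isZmodMorphism.Build L L (@frobenius F L) (@frobeniusB F L).
HB.instance Definition _ (F : finFieldType) (L : fieldExtType F) :=
  GRing.isMonoidMorphism.Build L L (@frobenius F L) (@frobeniusM F L).

(** The power map permutes the factors, so it fixes every coefficient; its fixed points are the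
    elements of [F]. *)
Lemma frobenius_prod_over (F : finFieldType) (L : fieldExtType F) (s : seq L) :
  uniq s -> (forall z, z \in s -> z ^+ #|F| \in s) ->
  exists g : {poly F}, \prod_(z <- s) ('X - z%:P) = map_poly (in_alg L) g.
Proof.
move=> us hs; apply/polyOver1P/polyOverP => l.
rewrite Fermat's_little_theorem dimv1 expn1 -[_ ^+ _]/(@frobenius F L _) -coef_map.
rewrite rmorph_prod /=; under eq_bigr => z _ do rewrite map_polyXsubC.
rewrite -(big_map (@frobenius F L) xpredT (fun z => 'X - z%:P)) (perm_big s) //.
have uf : uniq (map (@frobenius F L) s) by rewrite (map_inj_uniq (fmorph_inj _)).
have sf : {subset map (@frobenius F L) s <= s} by move=> _ /mapP [z zs ->]; apply: hs.
apply: uniq_perm => //.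
by have [] := uniq_min_size uf sf; rewrite ?size_map.
Qed.

(** Multiplication by [g] maps the polynomials of size at most [k = n - deg g] bijectively onto the
    code. *)
Lemma code_dim_dvdp (F : finFieldType) n (g : {poly F}) (C : {set 'rV[F]_n}) :
  g != 0 -> (size g <= n.+1)%N -> (forall c, (c \in C) = (g %| rVpoly c)) ->
  code_dim C = (n - (size g).-1)%N.
Proof.
move=> g0 sg hC; set k := (n - _)%N.
have sgp : (0 < size g)%N by rewrite size_poly_gt0.
have szM (v : 'rV[F]_k) : (size (rVpoly v * g)%R <= n)%N.
  have [->|v0] := eqVneq (rVpoly v) 0; first by rewrite mul0r size_poly0.
  have : (size (rVpoly v) <= k)%N by apply: size_poly.
  rewrite size_mul // /k; move: (size g) (size (rVpoly v)) sgp sg => *; lia.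
pose f (v : 'rV[F]_k) : 'rV[F]_n := poly_rV (rVpoly v * g).
have lin_f : linear f by move=> a u v; rewrite /f linearP mulrDl -scalerAl linearP.
pose flM := GRing.isLinear.Build _ _ _ _ f lin_f.
pose fL : {linear _ -> _} := HB.pack f flM.
pose phi := linfun fL.
have phiE v : phi v = poly_rV (rVpoly v * g) by rewrite lfunE.
have kphi : lker phi == 0%VS.
  apply/lker0P => u v; rewrite !phiE => /(congr1 rVpoly).
  rewrite !poly_rV_K // => /(mulIf g0) /(congr1 (@poly_rV _ k)).
  by rewrite !rVpolyK.
have <- : \dim (limg phi) = k.
  by rewrite limg_dim_eq ?dimvf ?dim_matrix ?mul1r // (eqP kphi) capv0.
congr (\dim _); apply/eqP; rewrite eqEsubv; apply/andP; split.
  apply/span_subvP => c; rewrite mem_enum hC => /dvdpP [r Er].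
  apply/memv_imgP; exists (poly_rV r : 'rV[F]_k); first exact: memvf.
  have sr : (size r <= k)%N.
    have [->|r0] := eqVneq r 0; first by rewrite size_poly0.
    have : (size (rVpoly c) <= n)%N by apply: size_poly.
    by rewrite Er size_mul // /k; move: (size g) (size r) sgp sg => *; lia.
  by rewrite phiE poly_rV_K // -Er rVpolyK.
apply/subvP => _ /memv_imgP [v _ ->]; apply: memv_span.
by rewrite mem_enum hC phiE poly_rV_K // dvdp_mull.
Qed.

(** [T] is the set of exponents of the common zeros: stable under multiplication by [#|F|],
    containing the range, and generated by it. The product of the ['X - beta ^+ j] over [T] is then
    a generator polynomial over [F]. *)
Lemma BCH_dim (F : finFieldType) (L : fieldExtType F) n (beta : L) delta b (T : {set 'I_n}) :
  n.-primitive_root beta ->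
  (forall j, j \in T -> exists2 j', j' \in T & j' = j * #|F| %[mod n])%N ->
  (forall i, (b <= i < b + delta.-1)%N -> exists2 j, j \in T & j = i %[mod n])%N ->
  (forall j, j \in T -> exists i k,
     [/\ b <= i, i < b + delta.-1 & j = i * #|F| ^ k %[mod n]])%N ->
  code_dim (BCH_code n beta delta b) = #|~: T|.
Proof.
move=> prim Tq Trange Tcov.
pose s := [seq beta ^+ val j | j <- enum T].
have us : uniq s.
  rewrite map_inj_uniq ?enum_uniq // => i j /eqP.
  by rewrite (eq_prim_root_expr prim) !(modn_small (ltn_ord _)) => /eqP /val_inj.
have sq z : z \in s -> z ^+ #|F| \in s.
  move=> /mapP [j]; rewrite mem_enum => /Tq [j' j'T Ej'] ->.
  apply/mapP; exists j'; first by rewrite mem_enum.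
  by rewrite -exprM; apply/eqP; rewrite (eq_prim_root_expr prim) Ej'.
have [g Eg] := frobenius_prod_over us sq.
have szg : size g = #|T|.+1.
  by rewrite -(size_map_poly (in_alg L)) -Eg size_prod_XsubC size_map -cardE.
have cT : (#|T| <= n)%N by rewrite (leq_trans (max_card _)) // card_ord.
rewrite cardsCs setCK card_ord (@code_dim_dvdp _ _ g) ?szg //.
  by rewrite -size_poly_eq0 szg.
move=> c; rewrite -(dvdp_map (in_alg L)) -Eg -/(poly_of_word L c).
apply/in_BCH_code/idP => [h|/dvdpP [r Er] i /Trange [j jT Ej]].
  apply: uniq_roots_dvdp; last by rewrite uniq_rootsE.
  apply/allP => z /mapP [j]; rewrite mem_enum => /Tcov [i [k [bi ib Ej]]] ->.
  have -> : beta ^+ val j = (beta ^+ i) ^+ (#|F| ^ k).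
    by apply/eqP; rewrite -exprM (eq_prim_root_expr prim) Ej.
  rewrite rootE word_horner_frobeniusX h ?bi // expr0n expn_eq0.
  by rewrite -[#|F| == 0%N]negbK -lt0n (ltnW (finNzRing_gt1 _)).
apply/rootP; rewrite Er; have -> : beta ^+ i = beta ^+ j.
  by apply/eqP; rewrite (eq_prim_root_expr prim) Ej.
rewrite rootM root_prod_XsubC; apply/orP; right.
by apply/mapP; exists j; rewrite ?mem_enum.
Qed.

(** The powers of [alpha] repeat after its order [d], yet exhaust the [Q.-1] nonzero elements. *)
Lemma generator_prim_root (F : finFieldType) (L : fieldExtType F) (alpha : L) :
  alpha != 0 -> (forall x : L, x != 0 -> exists k, x = alpha ^+ k) ->
  (#|F| ^ \dim {: L}).-1.-primitive_root alpha.
Proof.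
move=> a0 gen; set Q := (_ ^ _)%N.
pose T := finvect_type L.
have cT : #|T| = Q.
  by rewrite -(@card_vspacef F T (Vector.class (T : vectType F))) card_vspace.
have Q1 : (1 < Q)%N by rewrite -cT finNzRing_gt1.
have fermat : alpha ^+ Q.-1 = 1.
  apply: (mulIf a0); rewrite -exprSr prednK ?(ltnW Q1) // mul1r.
  by apply/eqP; rewrite -(Fermat's_little_theorem (aspacef L)) memvf.
have Q0 : (0 < Q.-1)%N by case: (Q) Q1 => [|[]].
have [d primd dQ] := prim_order_exists Q0 fermat.
suff -> : Q.-1 = d by [].
apply/eqP; rewrite eqn_leq [(d <= _)%N]dvdn_leq // andbT.
pose s : seq T := [seq alpha ^+ i | i <- iota 0 d].
have sub : {subset predC1 (0 : T) <= s}.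
  move=> x; rewrite inE => /gen [k ->]; rewrite -(prim_expr_mod primd).
  by apply: map_f; rewrite mem_iota ltn_mod (prim_order_gt0 primd).
rewrite -cT -(cardC1 (0 : T)).
have /subset_leq_card/leq_trans -> // : predC1 (0 : T) \subset s by apply/subsetP.
by rewrite (leq_trans (card_size _)) // size_map size_iota.
Qed.

(** * Cyclotomic cosets and their leaders *)

Local Open Scope nat_scope.

(** The search in [ord_mod] only inspects exponents up to [n], hence the upper bound on [r]. *)
Lemma ord_mod_eq n q r :
  0 < r <= n -> q ^ r %% n = 1 -> (forall e, 0 < e < r -> q ^ e %% n <> 1) ->
  ord_mod n q = r.
Proof.
case: r => // r /andP [_ rn] hr hmin; rewrite /ord_mod; congr _.+1.
set P := (fun _ => _).
have hP : has P (iota 0 n) by apply/hasP; exists r; rewrite ?mem_iota // /P hr.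
apply/eqP; rewrite eqn_leq; apply/andP; split.
  rewrite leqNgt; apply/negP => h.
  by have := before_find 0 h; rewrite nth_iota // /P add0n hr eqxx.
rewrite leqNgt; apply/negP => h.
have := nth_find 0 hP; rewrite nth_iota ?(leq_trans h (ltnW rn)) // /P add0n => /eqP.
by apply: hmin; rewrite /= ltnS h.
Qed.

Section Cosets.
Variables n q : nat.
Hypothesis n1 : 1 < n.
Hypothesis qr1 : q ^ ord_mod n q %% n = 1.

Lemma modn_mul_expr_mod s i : s * q ^ i = s * q ^ (i %% ord_mod n q) %[mod n].
Proof.
rewrite {1}(divn_eq i (ord_mod n q)) expnD mulnC [_ %/ _ * _]mulnC expnM.
rewrite -mulnA -modnMml -modnXm qr1 exp1n modnMml mul1n mulnC //.
Qed.

Lemma cyc_cosetP s x :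
  reflect (exists i, x = s * q ^ i %% n) (x \in cyc_coset n q s).
Proof.
apply: (iffP mapP) => [[i _ ->]|[i ->]]; first by exists i.
exists (i %% ord_mod n q); last exact: modn_mul_expr_mod.
by rewrite mem_iota ltn_mod.
Qed.

Lemma cyc_coset_lt s x : x \in cyc_coset n q s -> x < n.
Proof. by case/cyc_cosetP => i ->; rewrite ltn_mod ltnW. Qed.

Lemma cyc_coset_refl s : s < n -> s \in cyc_coset n q s.
Proof. by move=> sn; apply/cyc_cosetP; exists 0; rewrite expn0 muln1 modn_small. Qed.

Lemma cyc_coset_trans s x y :
  x \in cyc_coset n q s -> y \in cyc_coset n q x -> y \in cyc_coset n q s.
Proof.
case/cyc_cosetP => i -> /cyc_cosetP [j ->]; apply/cyc_cosetP; exists (i + j).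
by rewrite modnMml -mulnA expnD.
Qed.

Lemma cyc_coset_sym s x : s < n -> x \in cyc_coset n q s -> s \in cyc_coset n q x.
Proof.
move=> sn /mapP [i]; rewrite mem_iota /= => ir ->.
apply/cyc_cosetP; exists (ord_mod n q - i).
by rewrite modnMml -mulnA -expnD subnKC ?(ltnW ir) // -modnMmr qr1 muln1 modn_small.
Qed.

Lemma cyc_coset0 x : (x \in cyc_coset n q 0) = (x == 0).
Proof.
apply/cyc_cosetP/eqP => [[i ->]|->]; first by rewrite mul0n mod0n.
by exists 0; rewrite mul0n mod0n.
Qed.

Lemma coset_leaderP s :
  reflect (s < n /\ forall x, x \in cyc_coset n q s -> s <= x) (is_coset_leader n q s).
Proof.
by apply: (iffP andP) => [[sn /allP h]|[sn h]]; split=> //; apply/allP.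
Qed.

Lemma coset_leader_exists j : j < n ->
  exists2 s, is_coset_leader n q s & s \in cyc_coset n q j.
Proof.
move=> jn; have ex : exists x, x \in cyc_coset n q j.
  by exists j; apply: cyc_coset_refl.
have [s sj smin] := ex_minnP ex; exists s => //.
apply/coset_leaderP; split=> [|x xs]; first exact: cyc_coset_lt sj.
exact/smin/(cyc_coset_trans sj).
Qed.

Lemma coset_leader_uniq s s' : is_coset_leader n q s -> is_coset_leader n q s' ->
  s \in cyc_coset n q s' -> s = s'.
Proof.
move=> /coset_leaderP [sn hs] /coset_leaderP [sn' hs'] h.
by apply/eqP; rewrite eqn_leq hs' ?hs //; apply: cyc_coset_sym.
Qed.

Lemma mem_MinRep s : (s \in MinRep n q) = is_coset_leader n q s.
Proof.
rewrite mem_sort mem_filter mem_iota add0n /=; apply: andb_idr.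
by case/andP.
Qed.

Lemma MinRep_sorted : sorted geq (MinRep n q).
Proof. by apply: sort_sorted => x y; apply: leq_total. Qed.

(** Positivity rules out the default value [0] of [nth]. *)
Lemma delta_i_leader i : 0 < delta_i n q i -> is_coset_leader n q (delta_i n q i).
Proof.
rewrite -mem_MinRep /delta_i => h; apply: mem_nth; rewrite ltnNge.
by apply: contraL h => h; rewrite nth_default.
Qed.

(** [delta_i n q i.+1] sits at position [i] of a decreasing list, so a larger leader occurs at an
    earlier position. *)
Lemma delta_i_gt s i : is_coset_leader n q s -> delta_i n q i.+1 < s ->
  exists2 j, j < i & s = delta_i n q j.+1.
Proof.
rewrite -mem_MinRep => sM ds; exists (index s (MinRep n q)); last first.
  by rewrite /delta_i nth_index.
rewrite ltnNge; apply/negP => h.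
have szi : index s (MinRep n q) < size (MinRep n q) by rewrite index_mem.
have trgeq : transitive geq by move=> x y z h1 h2; apply: leq_trans h2 h1.
have [szi'|szi'] := leqP (size (MinRep n q)) i.
  by have := leq_ltn_trans h szi; rewrite ltnNge szi'.
have := sorted_leq_nth trgeq (fun x => leqnn x) 0 MinRep_sorted.
move=> /(_ _ _ szi' szi h); rewrite nth_index // => h'.
by move: ds; rewrite ltnNge; move/negP; apply.
Qed.
End Cosets.

(** * Sizes of cosets, and the dimension in terms of leaders *)

Definition coset_set n q s : {set 'I_n} := [set j | val j \in cyc_coset n q s].

Lemma card_coset_set n q s p : 1 < n -> q ^ ord_mod n q %% n = 1 -> 0 < p ->
  s * q ^ p = s %[mod n] ->
  (forall i j, i < j < p -> s * q ^ i <> s * q ^ j %[mod n]) ->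
  #|coset_set n q s| = p.
Proof.
move=> n1 qr1 p0 sp sinj; have n0 : 0 < n by exact: ltnW.
have red i : s * q ^ i = s * q ^ (i %% p) %[mod n].
  rewrite {1}(divn_eq i p); elim: (i %/ p) => [|k IH]; first by rewrite mul0n.
  by rewrite mulSn -addnA expnD mulnA -modnMml sp modnMml IH.
pose f (i : 'I_p) : 'I_n := Ordinal (ltn_pmod (s * q ^ i) n0).
have injf : injective f.
  move=> i j /(congr1 val) /= E; apply/val_inj; case: (ltngtP i j) => // ij.
    by case: (@sinj i j); rewrite ?ij ?ltn_ord.
  by case: (@sinj j i); rewrite ?ij ?ltn_ord.
have -> : coset_set n q s = [set f i | i : 'I_p].
  apply/setP => j; rewrite inE; apply/cyc_cosetP/imsetP => // [[i Ei]|[i _ ->]].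
    exists (Ordinal (ltn_pmod i p0)) => //; apply: val_inj; rewrite /= Ei red //.
  by exists i.
by rewrite card_imset // card_ord.
Qed.

Lemma card_coset_sets n q (ls : seq nat) : 1 < n -> q ^ ord_mod n q %% n = 1 ->
  uniq ls -> all (is_coset_leader n q) ls ->
  #|[set j : 'I_n | has (fun s => val j \in cyc_coset n q s) ls]| =
  \sum_(s <- ls) #|coset_set n q s|.
Proof.
move=> n1 qr1; elim: ls => [|s ls IH] /=.
  by rewrite big_nil => _ _; apply/eqP; rewrite cards_eq0; apply/eqP/setP => j; rewrite !inE.
move=> /andP [sls uls] /andP [ls0 lls]; rewrite big_cons -IH //.
set B := [set j : 'I_n | has _ ls].
have -> : [set j : 'I_n | (val j \in cyc_coset n q s) ||
   has (fun s => val j \in cyc_coset n q s) ls] = coset_set n q s :|: B.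
  by apply/setP => j; rewrite !inE.
rewrite cardsU; have -> : coset_set n q s :&: B = set0; last by rewrite cards0 subn0.
apply/setP => j; rewrite !inE; apply/negP => /andP [js /hasP [s' s'ls js']].
move: sls; rewrite (_ : s = s') ?s'ls //.
apply: (@coset_leader_uniq n q) => //; first exact: (allP lls).
apply: (@cyc_coset_trans n q qr1 _ j) => //.
by apply: (cyc_coset_sym qr1 _ js); case/andP: ls0.
Qed.

(** A coset meets the range exactly when its leader lies in it: the leader is minimal, and with
    [b <= 1] the only residue that can lie below the range is [0], alone in its coset. *)
Lemma BCH_dim_leaders (F : finFieldType) (L : fieldExtType F) n (beta : L)
    delta b (ls : seq nat) :
  1 < n -> #|F| ^ ord_mod n #|F| %% n = 1 -> (n.-primitive_root beta)%R ->
  b <= 1 -> b + delta.-1 <= n ->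
  uniq ls -> all (is_coset_leader n #|F|) ls ->
  (forall s, is_coset_leader n #|F| s -> (s \in ls) = ~~ (b <= s < b + delta.-1)) ->
  code_dim (BCH_code n beta delta b) = \sum_(s <- ls) #|coset_set n #|F| s|.
Proof.
set q := #|F| => n1 qr1 prim b1 bn uls lls hls; rewrite -card_coset_sets //.
set U := [set _ | _]; rewrite -[U]setCK.
have UP (j : 'I_n) : j \in ~: U <->
    exists2 i, b <= i < b + delta.-1 & i \in cyc_coset n q j.
  rewrite inE; split=> [jU|[i /andP [bi ib] ij]].
    have [s ls_s sj] := coset_leader_exists n1 qr1 (ltn_ord j).
    exists s => //; rewrite -[_ && _]negbK -hls //; apply: contra jU => sls.
    by rewrite inE; apply/hasP; exists s => //; apply: cyc_coset_sym sj.
  rewrite inE; apply/hasPn => s sls; apply/negP => js.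
  have /coset_leaderP [sn smin] : is_coset_leader n q s by apply: (allP lls).
  have is_ : i \in cyc_coset n q s by apply: cyc_coset_trans js ij.
  move: (hls s (allP lls _ sls)); rewrite sls => /esym/negP; apply.
  rewrite (leq_ltn_trans (smin _ is_) ib) // andbT.
  case: b b1 bi {bn ib hls} => [|[|]] // _ i0.
  rewrite lt0n; apply: contraL is_ => /eqP ->.
  by rewrite cyc_coset0 // -lt0n.
apply: BCH_dim => //.
- move=> j /UP [i ib ij]; exists (Ordinal (ltn_pmod (j * q) (ltnW n1))); last first.
    by rewrite /= modn_mod.
  apply/UP; exists i => //=; apply: (cyc_coset_trans qr1 _ ij).
  apply: cyc_coset_sym => //; apply/cyc_cosetP => //.
  by exists 1; rewrite expn1.
- move=> i ib; have ltin : i < n by case/andP: ib => _ /leq_trans ->.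
  exists (Ordinal ltin) => //; apply/UP; exists i => //=; exact: cyc_coset_refl.
move=> j /UP [i /andP [bi ib] ij].
have /(cyc_cosetP qr1) [k Ek] := cyc_coset_sym qr1 (ltn_ord j) ij.
by exists i, k; split=> //; rewrite Ek modn_mod.
Qed.

Lemma leader0 n q : 1 < n -> q ^ ord_mod n q %% n = 1 -> is_coset_leader n q 0.
Proof. by move=> n1 qr1; apply/coset_leaderP; split=> //; apply: ltnW. Qed.

Lemma card_coset_set0 n q : 1 < n -> q ^ ord_mod n q %% n = 1 -> #|coset_set n q 0| = 1.
Proof.
by move=> n1 qr1; apply: card_coset_set => // i [|j] //; rewrite ltnS andbC.
Qed.

Lemma delta_i_anti n q i j : i <= j -> delta_i n q j.+1 <= delta_i n q i.+1.
Proof.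
move=> ij; rewrite /delta_i /=.
have [h|h] := ltnP j (size (MinRep n q)); last by rewrite nth_default.
have trgeq : transitive geq by move=> x y z h1 h2; apply: leq_trans h2 h1.
have := sorted_leq_nth trgeq (fun x => leqnn x) 0 (MinRep_sorted n q).
by apply=> //; exact: leq_ltn_trans ij h.
Qed.


Lemma delta_i_inj n q i j : 0 < delta_i n q i.+1 ->
  delta_i n q i.+1 = delta_i n q j.+1 -> i = j.
Proof.
have lt_size k : 0 < delta_i n q k.+1 -> k < size (MinRep n q).
  by rewrite /delta_i ltnNge => h; rewrite ltnNge; apply: contra h => h; rewrite nth_default.
move=> i0 E; have j0 : 0 < delta_i n q j.+1 by rewrite -E.
apply/eqP; rewrite -(nth_uniq 0 (lt_size _ i0) (lt_size _ j0)); first exact/eqP.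
by rewrite sort_uniq filter_uniq ?iota_uniq.
Qed.

(** * Confined orbits of the expanding map *)

Local Open Scope ring_scope.

(** Since [0 < q * a <= q * E < 3 * n - E], any odd multiple of [n] other than [- n] would push [b]
    out of [[- E, E]]. *)
Lemma expanding_branch (n q E a b k : int) :
  0 < n -> E < n -> (q + 1) * E < 3 * n -> 2 <= q -> 0 < a <= E -> `|b| <= E ->
  b = q * a + n * (2 * k + 1) -> b = q * a - n.
Proof.
move=> n0 En qE q2 ha hb hk.
have qa : q * a <= q * E by nia.
have qa0 : 0 < q * a by nia.
have k0 : k < 0.
  case: (ltrP k 0) => // k0; have : 0 <= n * k by rewrite mulr_ge0 // ltW.
  lia.
have k1 : -2 < k.
  case: (ltrP (-2) k) => // k1.
  have : 0 <= n * (-2 - k) by rewrite mulr_ge0 ?(ltW n0) //; lia.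
  lia.
by rewrite hk (_ : k = -1); lia.
Qed.

(** When [s] is multiplied by an even [q], [n - 2s] is multiplied by [q] up to an odd multiple of
    [n]. [G] is the slack allowed beyond the largest value [A] of the periodic orbit. *)
Record confined_orbit (n q A B G : int) (w : nat -> int) : Prop := ConfinedOrbit {
  orbit_mul : forall i, exists k, w i.+1 = q * w i + n * (2 * k + 1);
  orbit_neq0 : forall i, w i != 0;
  orbit_le : forall i, `|w i| <= A + G
}.

Lemma confined_orbitN n q A B G w :
  confined_orbit n q A B G w -> confined_orbit n q A B G (fun i => - w i).
Proof.
case=> h1 h2 h3; split=> i; last 2 first.
- by rewrite oppr_eq0.
- by rewrite normrN.
have [k hk] := h1 i; exists (- k - 1); rewrite hk; ring.
Qed.

Section Confined.
Variables (n q A B G : int).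
(** The relations between [A] and [B] make [A, B, - A, - B] a periodic orbit. The bound [qG] amounts
    to [q ^+ 3 * G < 2 * B], and [ABG] is the condition of [expanding_branch] for [E = A + G]. *)
Hypotheses (q2 : 2 <= q) (B0 : 0 < B) (BA : B < A) (qA : q * A = n + B)
  (qB : q * B = n - A) (G0 : 0 <= G) (qG : q ^+ 4 * G < 2 * (n - A)).
Hypothesis ABG : A + B + (q + 1) * G < 2 * n.

Let n0 : 0 < n. Proof. have : 0 < q * B by rewrite mulr_gt0 //; lia. lia. Qed.

Let G16 : 16 * G <= q ^+ 4 * G.
Proof.
have h : 2 ^+ 4 <= q ^+ 4 by rewrite lerXn2r // nnegrE; lia.
by rewrite ler_wpM2r //; exact: h.
Qed.

Lemma orbit_next w i : confined_orbit n q A B G w -> 0 < w i -> w i.+1 = q * w i - n.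
Proof.
case=> h1 h2 h3 wi; have [k hk] := h1 i.
apply: (@expanding_branch n q (A + G) _ _ k) => //; first 2 last.
- have := h3 i; lia.
- lia.
- lia.
Qed.

(** Two steps multiply the deviation from the periodic orbit by [q ^+ 2]. Either the next pair of
    equal signs starts at [i.+2], or the sign changes once more and the pair starts at [i.+4]. *)
Lemma double_step_pos w i : confined_orbit n q A B G w -> 0 < w i -> 0 < w i.+1 ->
  [/\ w i.+2 < 0, w i.+3 < 0 & w i.+2 = - A + q ^+ 2 * (w i - A)] \/
  [/\ w i.+2 < 0, 0 < w i.+3, A < w i, w i.+4 < - A & w i.+4.+1 < 0].
Proof.
move=> hw w0 w1; have hN := confined_orbitN hw.
have E1 := orbit_next hw w0; have E2 := orbit_next hw w1.
have E2' : w i.+2 = - A + q ^+ 2 * (w i - A).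
  by rewrite E2 E1 expr2 !mulrBr !mulrA -(mulrA q q A) qA mulrDr qB; lia.
have le0 : w i - A <= G by have := orbit_le hw i; lia.
have q2G : 4 * (q ^+ 2 * G) <= q ^+ 4 * G.
  by rewrite mulrA ler_wpM2r // (exprD q 2 2) ler_pM2r ?exprn_gt0 ?expr2; nia.
have q3G : 2 * (q ^+ 3 * G) <= q ^+ 4 * G.
  by rewrite mulrA ler_wpM2r // (exprS q 3) ler_pM2r ?exprn_gt0; lia.
have q3B : q ^+ 3 * G < 2 * B.
  rewrite -(ltr_pM2l (_ : 0 < q)); last by lia.
  by rewrite mulrA -exprS mulrCA qB.
have q23 : 2 * (q ^+ 2 * G) <= q ^+ 3 * G.
  by rewrite mulrA ler_wpM2r // (exprS q 2) ler_pM2r ?exprn_gt0; lia.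
have f2 : q ^+ 2 * (w i - A) <= q ^+ 2 * G by rewrite ler_wpM2l // exprn_ge0; lia.
have f3 : q ^+ 3 * (w i - A) <= q ^+ 3 * G by rewrite ler_wpM2l // exprn_ge0; lia.
have w2 : w i.+2 < 0 by lia.
have E3 : w i.+3 = q * w i.+2 + n.
  by have := orbit_next hN (i := i.+2); rewrite oppr_gt0 => /(_ w2); lia.
have E3' : w i.+3 = - B + q ^+ 3 * (w i - A).
  by rewrite E3 E2' exprS mulrDr mulrN qA; ring.
have [w3|w3|/eqP] := ltrgt0P (w i.+3); last by rewrite (negbTE (orbit_neq0 hw _)).
  right; have E4 := orbit_next hw w3.
  have q1 : 0 < q by lia.
  (* The bound [q ^+ 3 * G < 2 * B] keeps [w i.+3] below [B], whose successor is [- A]. *)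
  have w4 : w i.+4 < - A.
    have : q * w i.+3 < q * B by rewrite ltr_pM2l; lia.
    lia.
  have w4N : w i.+4 < 0 by lia.
  have E5 : w i.+4.+1 = q * w i.+4 + n.
    by have := orbit_next hN (i := i.+4); rewrite oppr_gt0 => /(_ w4N); lia.
  split => //.
    rewrite ltNge; apply/negP => fA.
    have : q ^+ 3 * (w i - A) <= 0 by rewrite mulr_ge0_le0 ?exprn_ge0 //; lia.
    lia.
  have : q * w i.+4 < q * (- A) by rewrite ltr_pM2l.
  lia.
by left.
Qed.

Definition twin (w : nat -> int) i := (0 < w i) == (0 < w i.+1).

(** In the short alternative [|w| - A] changes sign, being multiplied by [- q ^+ 2]; in the long one
    both ends lie beyond [A]. A negative pair is a positive pair of [- w]. *)
Lemma twin_step w i : confined_orbit n q A B G w -> twin w i -> `|w i| != A ->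
  twin w i.+2 && ((A < `|w i.+2|) == ~~ (A < `|w i|)) \/
  [&& ~~ twin w i.+2, twin w i.+4, A < `|w i| & A < `|w i.+4|].
Proof.
move=> hw; have [wi|wi|/eqP] := ltrgt0P (w i); last by rewrite (negbTE (orbit_neq0 hw _)).
  rewrite /twin wi => /eqP/esym wi1 wA.
  have [[w2 w3 E2]|[w2 w3 w0 w4 w5]] := double_step_pos hw wi wi1.
    left; apply/andP; split; first by lia.
    have q2p : 0 < q ^+ 2 by rewrite exprn_gt0; lia.
    have [h|h] := ltrP A (w i).
      have : 0 < q ^+ 2 * (w i - A) by rewrite mulr_gt0 ?subr_gt0.
      lia.
    have : q ^+ 2 * (w i - A) < 0 by rewrite pmulr_rlt0 // subr_lt0; lia.
    lia.
  by right; lia.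
rewrite /twin => wi1 wA.
have hN := confined_orbitN hw; have w1 := orbit_neq0 hw i.+1.
have a0 : 0 < - w i by lia.
have a1 : 0 < - w i.+1 by lia.
have [[w2 w3 E2]|[w2 w3 w0 w4 w5]] := double_step_pos hN a0 a1.
  left; apply/andP; split; first by lia.
  have q2p : 0 < q ^+ 2 by rewrite exprn_gt0; lia.
  have [h|h] := ltrP A (- w i).
    have : 0 < q ^+ 2 * (- w i - A) by rewrite mulr_gt0 ?subr_gt0.
    lia.
  have : q ^+ 2 * (- w i - A) < 0 by rewrite pmulr_rlt0 // subr_lt0; lia.
  lia.
by right; lia.
Qed.

(* A step of length 4 keeps the side of [A] on which [`|w i|] lies, and a step
   of length 2 exchanges the sides: only [k] modulo 2 matters. *)
Lemma twin_parity w : confined_orbit n q A B G w -> (forall i, `|w i| != A) ->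
  forall k i, twin w i -> twin w (i + k.*2) ->
  (A < `|w (i + k.*2)%N|) = (A < `|w i|) (+) odd k.
Proof.
move=> hw hA k; have [K] := ubnP k; elim: K k => // K IH [|[|k]] kK i ti tk.
- by rewrite addn0 addbF.
- rewrite addn2 in tk *.
  have [/andP [_ /eqP ->]|/and4P [/negP]] := twin_step hw ti (hA i) => //.
  by rewrite addbT.
have [/andP [t2 /eqP E2]|/and4P [_ t4 h0 h4]] := twin_step hw ti (hA i).
  have := IH k.+1 _ i.+2 t2; rewrite !doubleS !addSn !addnS in tk *.
  move=> /(_ _ tk) ->; last by lia.
  by rewrite E2 /=; case: (A < _); case: odd.
have := IH k _ i.+4 t4; rewrite !doubleS !addSn !addnS in tk *.
move=> /(_ _ tk) ->; last by lia.
by rewrite h0 h4 /= negbK.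
Qed.

(** Without a twin the signs would alternate, so [w] would have equal signs at [0] and at the even
    time [4t + 2], against antiperiodicity. Between a twin and its translate by [2 (2t + 1)] the
    side of [A] is exchanged, although [|w|] is the same. *)
Lemma confined_orbit_meets w t : confined_orbit n q A B G w ->
  (forall i, w (i + (4 * t + 2))%N = - w i) -> ~ (forall i, `|w i| != A).
Proof.
move=> hw hm hA; have w0 := orbit_neq0 hw.
have [i ti] : exists i, twin w i.
  have [/existsP [i]|/existsPn hno] := boolP [exists i : 'I_(4 * t + 2), twin w i].
    by exists i.
  have alt k : (k.*2 <= 4 * t + 2)%N -> (0 < w k.*2) = (0 < w 0%N).
    elim: k => // k IH; rewrite doubleS => hk; rewrite -IH; last by lia.
    have k1 : (k.*2 < 4 * t + 2)%N by lia.
    have := hno (Ordinal k1); have := hno (Ordinal hk); rewrite /twin /=.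
    by do 3 case: (0 < _).
  have := alt (2 * t + 1)%N; have -> : ((2 * t + 1).*2 = 0 + (4 * t + 2))%N by lia.
  rewrite hm add0n => /(_ (leqnn _)); have := w0 0%N; lia.
have tm : twin w (i + (2 * t + 1).*2).
  have -> : ((2 * t + 1).*2 = 4 * t + 2)%N by lia.
  rewrite /twin hm -addSn hm; move: ti (w0 i) (w0 i.+1); rewrite /twin; lia.
have := twin_parity hw hA ti tm.
have -> : ((2 * t + 1).*2 = 4 * t + 2)%N by lia.
by rewrite hm normrN oddD oddM /= addbT; case: (A < _).
Qed.
End Confined.

(** * The two largest coset leaders *)

Local Open Scope nat_scope.

Lemma modn_mul_negative n q m x : n = q ^ m + 1 -> 0 < x %% n ->
  x * q ^ m %% n = n - x %% n.
Proof.
move=> nE x0; have n0 : 0 < n by rewrite nE addn1.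
have xn := ltn_pmod x n0.
have : x * q ^ m + x = 0 %[mod n] by rewrite addnC -mulnS -addn1 -nE modnMl mod0n.
rewrite -modnDmr -modnDml mod0n => /eqP.
have := ltn_pmod (x * q ^ m) n0; set y := _ %% n => yn.
rewrite -/(n %| y + x %% n) => /dvdnP [[|[|k]]]; nia.
Qed.

(** For [e > m] the residue is [n - q ^ (e - m)], still greater than [1]. *)
Lemma expn_mod_neq1 n q m e : n = q ^ m + 1 -> 1 < q -> 0 < m -> 0 < e < 2 * m ->
  q ^ e %% n <> 1.
Proof.
move=> nE q1 m0 /andP [e0 em].
have le_qm i : i <= m -> q ^ i < n by move=> im; rewrite nE addn1 ltnS leq_pexp2l // ltnW.
have lt1 i : 0 < i -> 1 < q ^ i by move=> i0; rewrite -(expn0 q) ltn_exp2l.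
have [em'|em'] := leqP e m; first by rewrite modn_small ?le_qm // => E; have := lt1 _ e0; lia.
have emm : e - m < m by lia.
have qn := le_qm _ (ltnW emm).
have -> : e = e - m + m by lia.
have p0 : 0 < q ^ (e - m) by rewrite expn_gt0 (ltnW q1).
rewrite expnD (modn_mul_negative nE) modn_small //.
have : q ^ (e - m) < q ^ m by rewrite ltn_exp2l.
rewrite nE; lia.
Qed.

Lemma expn_2m_mod n q m : n = q ^ m + 1 -> 1 < q -> 0 < m -> q ^ (2 * m) %% n = 1.
Proof.
move=> nE q1 m0; have qn : q ^ m < n by rewrite nE addn1.
rewrite mul2n -addnn expnD (modn_mul_negative nE) modn_small //.
  by rewrite nE addnC addnK.
by rewrite expn_gt0 (ltnW q1).
Qed.

Lemma ord_mod_2m n q m : n = q ^ m + 1 -> 1 < q -> 0 < m -> ord_mod n q = 2 * m.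
Proof.
move=> nE q1 m0; apply: ord_mod_eq.
- rewrite muln_gt0 m0 nE addn1; apply: (@leq_trans (2 ^ m)).
    rewrite -[in X in _ <= X](prednK m0) expnS leq_pmul2l //.
    by rewrite -[in X in X <= _](prednK m0) ltn_expl.
  by apply: leqW; rewrite leq_exp2r.
- exact: expn_2m_mod.
- by move=> e; apply: expn_mod_neq1.
Qed.

Lemma coprime_expn_succ n q m : n = q ^ m + 1 -> 0 < m -> coprime n q.
Proof.
move=> nE m0; rewrite nE -(prednK m0) expnS mulnC coprime_sym /coprime gcdnMDl.
by rewrite gcdn1.
Qed.

Lemma coset_mul_inj n q s p : 0 < q -> coprime n q ->
  (forall e, 0 < e < p -> ~~ (n %| s * (q ^ e).-1)) ->
  forall i j, i < j < p -> s * q ^ i <> s * q ^ j %[mod n].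
Proof.
move=> q0 nq h i j /andP [ij jp] E.
have [] := negP (h (j - i) _); first by lia.
have E' : s * q ^ j = s * (q ^ (j - i)).-1 * q ^ i + s * q ^ i.
  rewrite -mulnA -mulnDr; congr (_ * _).
  rewrite -[X in _ + X]mul1n -mulnDl addn1 prednK ?expn_gt0 ?q0 //.
  by rewrite -expnD subnK // ltnW.
move/eqP: E; rewrite eq_sym E' eqn_mod_dvd ?leq_addl // addnK Gauss_dvdl //.
exact: coprimeXr.
Qed.

(** The odd number [q ^ 2 + 1] differs by [2] from [(q - 1) (q + 1)]; for [e = 3],
    [q ^ 3 - 1 = (q - 1) (q ^ 2 + 1 + q)]. *)
Lemma coprime_sqr_succ h e : 0 < h -> 0 < e < 4 ->
  coprime ((2 * h) ^ 2 + 1) ((2 * h) ^ e).-1.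
Proof.
move=> h0 /andP [e0 e4]; set q := 2 * h.
have o1 : odd (q ^ 2 + 1) by rewrite oddD oddX /q oddM.
have om : odd q.-1 by rewrite /q; lia.
have c1 : coprime (q ^ 2 + 1) q.-1.
  have -> : q ^ 2 + 1 = (q.+1 * q.-1 + 2) by rewrite /q; nia.
  by rewrite coprime_sym /coprime gcdnMDl -/(coprime _ _) coprimen2.
have c2 : coprime (q ^ 2 + 1) q.+1.
  have -> : q ^ 2 + 1 = (q.-1 * q.+1 + 2) by rewrite /q; nia.
  by rewrite coprime_sym /coprime gcdnMDl -/(coprime _ _) coprimen2 /q; lia.
case: e e0 e4 => [|[|[|[|]]]] // _ _.
- have -> : (q ^ 2).-1 = q.-1 * q.+1 by rewrite /q; nia.
  by rewrite coprimeMr c1 c2.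
- have -> : (q ^ 3).-1 = q.-1 * (1 * (q ^ 2 + 1) + q) by rewrite /q; nia.
  rewrite coprimeMr c1 /coprime gcdnMDl -/(coprime _ _).
  exact: (@coprime_expn_succ _ _ 2).
Qed.

(** * The quotients [N] and [P], and the two candidate leaders *)

Definition quot q t := (q ^ (4 * t + 2) + 1) %/ (q ^ 2 + 1).

Lemma quotE q t : (q ^ 2 + 1) * quot q t = q ^ (4 * t + 2) + 1.
Proof.
rewrite mulnC divnK //; elim: t => [|t IH]; first by rewrite dvdnn.
(* For [q = 0] the identity fails, but then the divisor is [1]. *)
have E : q ^ (4 * t.+1 + 2) + 1 + (q ^ 4).-1 = q ^ 4 * (q ^ (4 * t + 2) + 1) \/ q = 0.
  have [->|q0] := posnP q; first by right.
  left; have : 0 < q ^ 4 by rewrite expn_gt0 q0.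
  have -> : 4 * t.+1 + 2 = 4 + (4 * t + 2) by lia.
  by rewrite expnD; nia.
have [E'|->] := E; last by rewrite dvd1n.
rewrite -(dvdn_addl (n := (q ^ 4).-1)).
  by rewrite E' dvdn_mull.
have -> : (q ^ 4).-1 = (q ^ 2).-1 * (q ^ 2 + 1).
  rewrite (expnM q 2 2); set a := q ^ 2; nia.
by rewrite dvdn_mull.
Qed.

Lemma quotS q t : quot q t.+1 + q ^ 2 = q ^ 4 * quot q t + 1.
Proof.
have := quotE q t; have := quotE q t.+1.
have -> : 4 * t.+1 + 2 = 4 + (4 * t + 2) by lia.
rewrite expnD (expnM q 2 2) => E1 E2; set a := q ^ 2 in E1 E2 *.
have a1 : 0 < a + 1 by lia.
apply/eqP; rewrite -(eqn_pmul2l a1) mulnDr E1 mulnDr mulnCA E2; apply/eqP; ring.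
Qed.

Lemma quot_gt0 q t : 0 < quot q t.
Proof. have := quotE q t; lia. Qed.

Definition first_leader h t := h * (2 * h).-1 * quot (2 * h) t.
(** The index is shifted: this one belongs to [m = 4 * t.+1 + 2], next to [first_leader h t.+1]. *)
Definition second_leader h t :=
  h * (2 * h).-1 * (quot (2 * h) t.+1 - 2 * quot (2 * h) t).

(** By [quotS] the difference of the sides is a sum of nonnegative terms. The estimate gives
    [2P < N] and controls the first four steps of the orbit of [second_leader]. *)
Lemma quotS_bound h t : 0 < h ->
  ((2 * h) ^ 3).-1 * (2 * h).-1 * quot (2 * h) t <= quot (2 * h) t.+1.
Proof.
move=> h0; have := quotS (2 * h) t; have := quot_gt0 (2 * h) t.
move: (quot _ t.+1) (quot _ t) => N P P0.
have [q ->] : exists q, 2 * h = q.+2 by exists (2 * h - 2); lia.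
case: P P0 => // p _ E; rewrite -(leq_add2r (q.+2 ^ 2)) E.
have -> : (q.+2 ^ 3).-1 = q.+1 * (q.+2 ^ 2 + q.+2 + 1).
  by apply: succn_inj; rewrite prednK ?expn_gt0 //; ring.
have -> : q.+2 ^ 4 * p.+1 + 1 = q.+1 * (q.+2 ^ 2 + q.+2 + 1) * q.+2.-1 * p.+1 + q.+2 ^ 2
   + (q.+2 ^ 3 * p + (q.+2 ^ 2 * q.+1 + q.+1 * p.+1 + 1)) by rewrite /=; ring.
exact: leq_addr.
Qed.

Lemma quotS_double h t : 0 < h -> 2 * quot (2 * h) t < quot (2 * h) t.+1.
Proof.
move=> h0; apply: leq_trans (quotS_bound t h0).
have c3 : 3 <= ((2 * h) ^ 3).-1 * (2 * h).-1.
  have : 2 ^ 3 <= (2 * h) ^ 3 by rewrite leq_exp2r //; lia.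
  rewrite -[2 ^ 3]/8 => q3; rewrite -[X in X <= _](muln1 3) leq_mul //; last by lia.
  by case: ((2 * h) ^ 3) q3 => [|[|[|[|c]]]].
apply: leq_trans (leq_mul c3 (leqnn _)); have := quot_gt0 (2 * h) t; lia.
Qed.

Lemma PoszX (q k : nat) : ((q ^ k)%N%:Z = q%:Z ^+ k)%R.
Proof. by elim: k => // k IH; rewrite expnS PoszM IH exprS. Qed.

(** Otherwise [w = n - 2s] would be a confined orbit that never meets [A] in absolute value. *)
Lemma meets_first_leader h t n q m s : q = 2 * h -> m = 4 * t.+1 + 2 ->
  0 < h -> n = q ^ m + 1 -> is_coset_leader n q s -> second_leader h t < s ->
  first_leader h t.+1 \in cyc_coset n q s.
Proof.
move=> qE mE h0 nE ls hs.
have q1 : 1 < q by lia.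
have m0 : 0 < m by lia.
have n1 : 1 < n by rewrite nE addn1 ltnS expn_gt0 (ltnW q1).
have n0 : 0 < n by lia.
have om : ord_mod n q = 2 * m by apply: ord_mod_2m.
have qr1 : q ^ ord_mod n q %% n = 1 by rewrite om; apply: expn_2m_mod.
have [sn smin] := coset_leaderP _ _ _ ls.
have hN := quotE q t.+1; rewrite -mE -nE in hN.
have hP := quotS q t; have P0 := quot_gt0 q t; have PN := ltnW (quotS_double t h0).
move: hs hN hP P0 PN; rewrite /first_leader /second_leader -qE.
move: (quot q t.+1) (quot q t) => N P hs hN hP P0 PN.
have s0 : 0 < s by apply: leq_ltn_trans hs.
pose s_ i := s * q ^ i %% n.
have s_in i : s_ i \in cyc_coset n q s by apply/cyc_cosetP => //; exists i.
have s_ge i : s <= s_ i by apply: smin.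
have s_lt i : s_ i < n by rewrite ltn_pmod.
have s_m i : s_ (i + m) = n - s_ i.
  by rewrite /s_ expnD mulnA (modn_mul_negative nE) // (leq_trans s0 (s_ge i)).
have s_S i : exists k, s_ i * q = k * n + s_ i.+1.
  by exists (s_ i * q %/ n); rewrite {1}(divn_eq (s_ i * q) n) /s_ modnMml expnSr mulnA.
pose w i : int := (n%:Z - 2 * (s_ i)%:Z)%R.
have hm i : (w (i + m)%N = - w i)%R by rewrite /w s_m; have := s_lt i; lia.
apply: contraT => notin.
have Ex : (q%:Z = 2 * h%:Z)%R by rewrite qE PoszM.
have En : (n%:Z = (q%:Z ^+ 2 + 1) * N%:Z)%R by rewrite -hN PoszM PoszD PoszX.
have EN : (N%:Z + q%:Z ^+ 2 = q%:Z ^+ 4 * P%:Z + 1)%R.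
  by have := congr1 Posz hP; rewrite !PoszD PoszM !PoszX.
have Ep : (q.-1%:Z = q%:Z - 1)%R by lia.
have E1 : (2 * (h * q.-1 * N)%:Z = q%:Z * (q%:Z - 1) * N%:Z)%R.
  by rewrite !PoszM Ep Ex; ring.
have E2 : (2 * (h * q.-1 * (N - 2 * P))%:Z = q%:Z * (q%:Z - 1) * (N%:Z - 2 * P%:Z))%R.
  by rewrite !PoszM Ep -subzn // PoszM Ex; ring.
have x2 : (2 <= q%:Z)%R by lia.
have y0 : (0 < N%:Z)%R by lia.
have p0 : (0 < P%:Z)%R by lia.
move: (h * q.-1 * N) (h * q.-1 * (N - 2 * P)) E1 E2 notin hs => D1 D2 E1 E2 notin hs.
have EA : (n%:Z - (q%:Z + 1) * N%:Z = 2 * D1%:Z)%R by rewrite E1 En; ring.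
(* The value [A] occurs when [s_ i = D1], the value [- A] when [s_ (i + m) = D1]. *)
have hA i : (`|w i| != (q%:Z + 1) * N%:Z)%R.
  have ne j : s_ j <> D1 by move=> E; move: notin; rewrite -E s_in.
  rewrite /w; have := ne i; have := ne (i + m); rewrite s_m; have := s_lt i; lia.
(* As [n - 2 * D2 = A + 2q(q - 1)P], a residue strictly above [D2] saves a further [2]; this fixes
   the slack [G]. *)
have hle i : (`|w i| <= (q%:Z + 1) * N%:Z + (2 * q%:Z * (q%:Z - 1) * P%:Z - 2))%R.
  have := s_ge i; have := s_ge (i + m); rewrite s_m /w; have := s_lt i.
  have : (2 * D2%:Z = 2 * D1%:Z - 2 * q%:Z * (q%:Z - 1) * P%:Z)%R by rewrite E1 E2; ring.
  lia.
have hmul i : (exists k, w i.+1 = q%:Z * w i + n%:Z * (2 * k + 1))%R.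
  have [k hk] := s_S i; exists (k%:Z - h%:Z)%R; rewrite /w.
  have E : ((s_ i)%:Z * q%:Z = k%:Z * n%:Z + (s_ i.+1)%:Z)%R.
    by have := congr1 Posz hk; rewrite PoszD !PoszM.
  have -> : ((s_ i.+1)%:Z = (s_ i)%:Z * q%:Z - k%:Z * n%:Z)%R by rewrite E; ring.
  by rewrite Ex; ring.
have on : odd n by rewrite nE qE oddD oddX oddM /= orbF; case: (m) m0.
have hw0 i : (w i != 0)%R by rewrite /w; move: on; lia.
rewrite mE in hm.
move: x2 y0 p0 En EN EA hA hle hmul; move: q%:Z%R N%:Z%R P%:Z%R => x y p.
move=> x2 y0 p0 En EN EA hA hle hmul; exfalso.
have x20 : (0 < x ^+ 2)%R by rewrite exprn_gt0; lia.
have x40 : (0 < x ^+ 4)%R by rewrite exprn_gt0; lia.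
have xx : (0 < x * (x - 1))%R by rewrite mulr_gt0; lia.
have xp : (x * (x - 1) * 1 <= x * (x - 1) * p)%R by rewrite ler_wpM2l; lia.
(* The sides differ by [2x(x^2 + x - 1)] only, a quantity free of [y] and [p]. *)
have q4G : (x ^+ 4 * (2 * x * (x - 1) * p - 2) < 2 * (n%:Z - (x + 1) * y))%R.
  have -> : (x ^+ 4 * (2 * x * (x - 1) * p - 2) =
    2 * x * (x - 1) * (x ^+ 4 * p + 1) - 2 * x * (x - 1) - 2 * x ^+ 4)%R by ring.
  rewrite -EN En -subr_gt0.
  have -> : (2 * ((x ^+ 2 + 1) * y - (x + 1) * y) - (2 * x * (x - 1) * (y + x ^+ 2)
    - 2 * x * (x - 1) - 2 * x ^+ 4) = 2 * x * (x ^+ 2 + (x - 1)))%R by ring.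
  by rewrite !mulr_gt0 //; lia.
have G0 : (0 <= 2 * x * (x - 1) * p - 2)%R.
  have : (2 * 1 <= x * (x - 1))%R by rewrite ler_pM //; lia.
  lia.
have x1G : ((x + 1) * (2 * x * (x - 1) * p - 2) <=
    x ^+ 4 * (2 * x * (x - 1) * p - 2))%R.
  rewrite ler_wpM2r //; have h1 : (x + 1 <= x ^+ 2)%R by rewrite expr2; nia.
  apply: le_trans h1 _; rewrite -[leLHS]mulr1 (exprD x 2 2) ler_pM2l //; lia.
apply: (@confined_orbit_meets n%:Z x ((x + 1) * y) ((x - 1) * y)
  (2 * x * (x - 1) * p - 2) _ _ _ _ _ _ _ _ w t.+1 _ hm hA)%R => //.
- by rewrite mulr_gt0 //; lia.
- by rewrite ltr_pM2r //; lia.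
- by rewrite En; ring.
- by rewrite En; ring.
- rewrite En in q4G *; lia.
Qed.

Lemma first_leader_mod h t n q m i : q = 2 * h -> m = 4 * t + 2 -> n = q ^ m + 1 ->
  first_leader h t * q ^ i %% n = quot q t * ((h * q.-1 * q ^ i) %% (q ^ 2 + 1)).
Proof.
move=> qE mE nE; rewrite /first_leader -qE nE mE -quotE.
by rewrite muln_modr; congr (_ %% _); ring.
Qed.

Lemma sqr_pred a : 0 < a -> a ^ 2 = a.-1 * (a + 1) + 1.
Proof. by case: a => // a _; rewrite /=; ring. Qed.

(** Multiplication by [q] modulo [q ^ 2 + 1] moves [c] through [c], [c + 1], [- c], [- c - 1] with
    period 4; since [2 * c + q = q ^ 2], [c] is the least of these residues. *)
Lemma half_triangle_mod h q i : 0 < h -> q = 2 * h ->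
  h * q.-1 <= h * q.-1 * q ^ i %% (q ^ 2 + 1).
Proof.
move=> h0 qE; set Q := q ^ 2 + 1; set c := h * q.-1.
have [k hk] : exists k, h = k.+1 by exists h.-1; lia.
have qk : q = (2 * k + 1).+1 by lia.
have cE : 2 * c + q = q ^ 2 by rewrite /c hk qk /=; ring.
have c0 : 0 < c by rewrite /c muln_gt0 h0; lia.
have c1 : c * q = c + 1 %[mod Q].
  have -> : c * q = h.-1 * Q + (c + 1) by rewrite /c /Q hk qk /=; ring.
  by rewrite modnMDl.
have q2 : 2 <= q by lia.
have c2 : forall j, c * q ^ (4 * j) = c %[mod Q].
  elim=> [|j IH]; first by rewrite muln1.
  have -> : 4 * j.+1 = 4 * j + 4 by lia.
  rewrite expnD mulnA -modnMml IH modnMml (expnM q 2 2) sqr_pred ?expn_gt0 ?(ltnW q2) //.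
  by rewrite mulnDr muln1 mulnA modnMDl.
have q2q : 2 * q <= q ^ 2 by rewrite expnS expn1 leq_mul2r q2 orbT.
rewrite (divn_eq i 4) expnD mulnA mulnC [i %/ 4 * 4]mulnC -modnMmr c2 modnMmr mulnC.
have : i %% 4 < 4 by rewrite ltn_mod.
case: (i %% 4) => [|[|[|[|]]]] // _.
- by rewrite muln1 modn_small // /Q; lia.
- by rewrite expn1 c1 modn_small /Q; lia.
- have -> : c * q ^ 2 = c.-1 * Q + (Q - c).
    have E1 : c.-1 * Q = c.-1 * q ^ 2 + c.-1 by rewrite /Q; ring.
    have E2 : c * q ^ 2 = c.-1 * q ^ 2 + q ^ 2 by rewrite -{1}(prednK c0) mulSn addnC.
    by rewrite E1 E2 /Q; lia.
  by rewrite modnMDl modn_small /Q; lia.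
rewrite (expnS q 2) mulnA -modnMml c1 modnMml.
have -> : (c + 1) * q ^ 2 = c * Q + (Q - c - 1) by rewrite /Q mulnDr mulnDl; lia.
by rewrite modnMDl modn_small /Q; lia.
Qed.

Lemma first_leader_leader h t n q m : 0 < h -> q = 2 * h -> m = 4 * t + 2 ->
  n = q ^ m + 1 -> is_coset_leader n q (first_leader h t).
Proof.
move=> h0 qE mE nE; have q1 : 1 < q by lia.
have m0 : 0 < m by lia.
have qr1 : q ^ ord_mod n q %% n = 1 by rewrite (ord_mod_2m nE) // expn_2m_mod.
apply/coset_leaderP; split.
  rewrite nE mE -quotE /first_leader -qE mulnC [X in _ < X]mulnC ltn_pmul2l ?quot_gt0 //.
  by rewrite qE; nia.
move=> x /(cyc_cosetP qr1) [i ->]; rewrite (first_leader_mod _ qE mE nE).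
by rewrite /first_leader -qE mulnC leq_mul2l half_triangle_mod ?orbT.
Qed.

(** The period divides 4 because [q ^ 2 + 1] divides [q ^ 4 - 1]; a shorter one would make
    [q ^ 2 + 1] divide [h]. *)
Lemma card_first_leader h t n q m : 0 < h -> q = 2 * h -> m = 4 * t + 2 ->
  n = q ^ m + 1 -> #|coset_set n q (first_leader h t)| = 4.
Proof.
move=> h0 qE mE nE; have q1 : 1 < q by lia.
have m0 : 0 < m by lia.
have n1 : 1 < n by rewrite nE addn1 ltnS expn_gt0 (ltnW q1).
have qr1 : q ^ ord_mod n q %% n = 1 by rewrite (ord_mod_2m nE) // expn_2m_mod.
have nN : n = quot q t * (q ^ 2 + 1) by rewrite nE mE -quotE mulnC.
have c3 e : 0 < e < 4 -> coprime (q ^ 2 + 1) (q ^ e).-1.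
  by rewrite qE; apply: coprime_sqr_succ.
have Q1 : 1 < q ^ 2 + 1 by rewrite addn1 ltnS expn_gt0 (ltnW q1).
apply: card_coset_set => //.
  apply/eqP; rewrite eqn_mod_dvd; last by rewrite leq_pmulr // expn_gt0 (ltnW q1).
  have -> : q ^ 4 = (q ^ 2).-1 * (q ^ 2 + 1) + 1.
    by rewrite (expnM q 2 2) sqr_pred ?expn_gt0 ?(ltnW q1).
  rewrite mulnDr muln1 addnK nN /first_leader -qE; apply/dvdnP.
  by exists (h * q.-1 * (q ^ 2).-1); ring.
apply: coset_mul_inj; rewrite ?(ltnW q1) //; first exact: coprime_expn_succ nE m0.
move=> e he; rewrite nN /first_leader -qE mulnAC mulnC dvdn_pmul2r ?quot_gt0 //.
rewrite Gauss_dvdl ?c3 // Gauss_dvdl; last by have := c3 1 isT; rewrite expn1.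
apply/negP => /dvdn_leq; rewrite qE => /(_ h0); nia.
Qed.

Lemma card_coset_sqr_succ n q h s : 0 < h -> q = 2 * h -> n = q ^ 2 + 1 -> 0 < s < n ->
  #|coset_set n q s| = 4.
Proof.
move=> h0 qE nE /andP [s0 sn]; have q1 : 1 < q by lia.
have n1 : 1 < n by rewrite nE addn1 ltnS expn_gt0 (ltnW q1).
have qr1 : q ^ ord_mod n q %% n = 1 by rewrite (ord_mod_2m nE) // expn_2m_mod.
apply: card_coset_set => //.
  by rewrite -modnMmr (expn_2m_mod (m := 2) nE q1) // muln1.
apply: coset_mul_inj; rewrite ?(ltnW q1) //; first exact: coprime_expn_succ nE _.
move=> e he; rewrite Gauss_dvdl; last by rewrite nE qE; apply: coprime_sqr_succ.
by rewrite gtnNdvd.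
Qed.

(** For even [m] the sum is [2] modulo [q ^ 2 - 1], which is odd. *)
Lemma coprime_succ_sqr_pred q m : 0 < q -> ~~ odd q -> ~~ odd m -> 0 < m ->
  coprime (q ^ m + 1) (q ^ 2).-1.
Proof.
move=> q0 oq om m0; have q20 : 0 < q ^ 2 by rewrite expn_gt0 q0.
rewrite coprime_sym -coprime_modr -modnDml.
have -> : q ^ m = 1 %[mod (q ^ 2).-1].
  have e2 : q ^ 2 = 1 %[mod (q ^ 2).-1] by rewrite -{1}(prednK q20) -addn1 modnDl.
  have -> : m = 2 * m./2 by lia.
  by rewrite expnM -modnXm e2 modnXm exp1n.
rewrite modnDml coprime_modr coprimen2.
by rewrite -[odd _]negbK -oddS prednK // oddX (negbTE oq).
Qed.

(** Here [u] is half of [m = 4 * t.+1 + 2]. *)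
Lemma quot_gt h t q u : 0 < h -> q = 2 * h -> u = 2 * t + 3 -> q ^ u + 1 < quot q t.+1.
Proof.
move=> h0 qE uE; have := quotE q t.+1.
have -> : 4 * t.+1 + 2 = u + u by lia.
rewrite expnD; have aq : q ^ 3 <= q ^ u by rewrite leq_pexp2l //; lia.
have q38 : 2 * q ^ 2 <= q ^ 3 by rewrite (expnS q 2) leq_mul2r; apply/orP; right; lia.
have q24 : 4 <= q ^ 2 by rewrite -[4]/(2 ^ 2) leq_exp2r //; lia.
move: (q ^ u) (quot _ _) (q ^ 2) (leq_trans q38 aq) q24 => a N b ba b4 E.
rewrite ltnNge; apply/negP => Na.
have E1 : (b + 1) * N <= (b + 1) * (a + 1) by rewrite leq_mul2l Na orbT.
have E2 : 2 * b * a <= a * a by rewrite leq_mul2r ba orbT.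
have E3 : 4 * a <= b * a by rewrite leq_mul2r b4 orbT.
lia.
Qed.

(** Every exponent below [2m] is within [u = m / 2] of [0], [m] or [2m]. As [q ^ m] is [-1] modulo
    [N], divisibility would pass to [q ^ r - 1] or [q ^ r + 1] with [r <= u], and these are smaller
    than [N]. *)
Lemma quot_expn_mod h t q m e : 0 < h -> q = 2 * h -> m = 4 * t.+1 + 2 ->
  0 < e < 2 * m -> ~~ (quot q t.+1 %| (q ^ e).-1).
Proof.
move=> h0 qE mE /andP [e0 em].
have NM : quot q t.+1 %| q ^ m + 1 by rewrite mE -quotE dvdn_mull.
have := @quot_gt h t q (2 * t + 3) h0 qE erefl.
move: (quot _ _) NM => N NM Nu; set u := 2 * t + 3 in Nu.
have qp i : 0 < q ^ i by rewrite expn_gt0; lia.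
have le_u i : i <= u -> q ^ i <= q ^ u by move=> iu; rewrite leq_pexp2l //; lia.
have S1 r : 0 < r <= u -> ~~ (N %| (q ^ r).-1).
  move=> /andP [r0 ru]; rewrite gtnNdvd //; last by have := le_u _ ru; lia.
  have : 1 < q ^ r by rewrite -(expn0 q) ltn_exp2l; lia.
  lia.
have S2 r : r <= u -> ~~ (N %| q ^ r + 1).
  by move=> ru; rewrite gtnNdvd //; have := le_u _ ru; lia.
apply/negP => Ne.
have [eu|eu] := leqP e u; first by have := S1 e; rewrite e0 eu Ne => /(_ isT).
have cancel r : (q ^ r).-1 * q ^ e + q ^ e = q ^ (r + e).
  by rewrite expnD -[X in _ + X]mul1n -mulnDl addn1 prednK.
have [em'|em'] := leqP e m.
  have := S2 (m - e); rewrite -(dvdn_addr _ (dvdn_mull (q ^ (m - e)) Ne)).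
  have -> : q ^ (m - e) * (q ^ e).-1 + (q ^ (m - e) + 1) = q ^ m + 1.
    rewrite addnA -mulnSr prednK // -expnD subnK //.
  by rewrite NM => /(_ _) /negP; apply; lia.
have [em2|em2] := leqP (e - m) u.
  have := S2 (e - m) em2; rewrite -(dvdn_addr _ Ne).
  have -> : (q ^ e).-1 + (q ^ (e - m) + 1) = q ^ (e - m) * (q ^ m + 1).
    by rewrite mulnDr muln1 -expnD subnK 1?ltnW // addnCA addn1 prednK // addnC.
  by rewrite dvdn_mull.
have := S1 (2 * m - e); rewrite -(dvdn_addr _ (dvdn_mull (q ^ (2 * m - e)) Ne)).
have -> : q ^ (2 * m - e) * (q ^ e).-1 + (q ^ (2 * m - e)).-1 = (q ^ m).-1 * (q ^ m + 1).
  apply: succn_inj; rewrite -addnS prednK // -mulnSr prednK // -expnD subnK 1?ltnW //.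
  by rewrite mulnC expnM sqr_pred // addn1.
rewrite dvdn_mull // => /(_ _) /negP; apply => //; lia.
Qed.

(** Coprimality with [N] turns a period of the coset into an exponent [e] with [N] dividing
    [q ^ e - 1]. *)
Lemma card_second_leader h t n q m : 0 < h -> q = 2 * h -> m = 4 * t.+1 + 2 ->
  n = q ^ m + 1 -> #|coset_set n q (second_leader h t)| = 2 * m.
Proof.
move=> h0 qE mE nE; have q1 : 1 < q by lia.
have m0 : 0 < m by lia.
have n1 : 1 < n by rewrite nE addn1 ltnS expn_gt0 (ltnW q1).
have qr1 : q ^ ord_mod n q %% n = 1 by rewrite (ord_mod_2m nE) // expn_2m_mod.
have nN : n = (q ^ 2 + 1) * quot q t.+1 by rewrite nE mE quotE.
have Nn : quot q t.+1 %| n by rewrite nN dvdn_mull.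
have cN : coprime (quot q t.+1) (second_leader h t).
  have hS := quotS q t.
  have c1 : coprime (quot q t.+1) (q ^ 2).-1.
    apply: coprime_dvdl Nn _; rewrite nE coprime_succ_sqr_pred //; lia.
  have cq : coprime (quot q t.+1) q.
    exact: coprime_dvdl Nn (coprime_expn_succ nE m0).
  have c2 : coprime (quot q t.+1) 2 by move: cq; rewrite qE coprimeMr => /andP [].
  have ch : coprime (quot q t.+1) h by move: cq; rewrite {2}qE coprimeMr => /andP [].
  have cq1 : coprime (quot q t.+1) q.-1.
    move: c1; rewrite sqr_pred ?(ltnW q1) // addn1.
    by rewrite coprimeMr => /andP [].
  have q20 : 0 < q ^ 2 by rewrite expn_gt0 (ltnW q1).
  (* Modulo [N], [q ^ 4 * P] equals [q ^ 2 - 1], already known to be coprime to [N]. *)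
  have cP : coprime (quot q t.+1) (quot q t).
    have : coprime (quot q t.+1) (q ^ 4 * quot q t).
      have -> : q ^ 4 * quot q t = quot q t.+1 + (q ^ 2).-1 by lia.
      by rewrite /coprime gcdnDl.
    by rewrite coprimeMr => /andP [].
  rewrite /second_leader -qE !coprimeMr ch cq1 /=.
  have PN := ltnW (quotS_double t h0); rewrite -qE in PN.
  have : coprime (quot q t.+1) (2 * quot q t) by rewrite coprimeMr c2.
  move: PN; move: (quot q t.+1) (2 * quot q t) => N P2 PN.
  by rewrite -{1 2}(subnK PN) /coprime gcdnC gcdnDr gcdnC => /eqP E; rewrite gcdnC gcdnDl E.
apply: card_coset_set => //; first by rewrite muln_gt0.
  by rewrite -modnMmr (expn_2m_mod nE q1) // muln1.
apply: coset_mul_inj; rewrite ?(ltnW q1) //; first exact: coprime_expn_succ nE m0.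
move=> e he; apply: contra (quot_expn_mod h0 qE mE he) => /(dvdn_trans Nn).
by rewrite Gauss_dvdr.
Qed.

(** * The second candidate is a coset leader *)

Local Open Scope ring_scope.

(** The interval [[D, n - D]] is symmetric under negation modulo [n], so only the exponents below
    [m] have to be checked. *)
Definition balanced (n D a : int) := exists r z, a = r + n * z /\ D <= r <= n - D.

Section Balanced.
Variables (h x y p n : int).
Hypotheses (h0 : 0 < h) (xE : x = 2 * h) (y0 : 0 < y) (p0 : 0 < p)
  (yE : y = x ^+ 4 * p - x ^+ 2 + 1) (nE : n = (x ^+ 2 + 1) * y).
Hypothesis yp : (x ^+ 3 - 1) * (x - 1) * p <= y.
(** With [x = q], [y = N], [p = P], [D] is the second candidate and [phi] its distance to the first
    one, [c * y]; [dl] is the deviation left after four steps. *)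
Let c := h * (x - 1).
Let phi := x * (x - 1) * p.
Let D := c * y - phi.
Let dl := x * (x - 1) ^+ 2 * (x + 1).

Let x2 : 2 <= x. Proof. by rewrite xE; lia. Qed.
Let cE : 2 * c = x * (x - 1). Proof. by rewrite /c xE; ring. Qed.
Let n_c : n = 2 * (c * y) + (x + 1) * y.
Proof. by rewrite nE mulrA cE; ring. Qed.
Let phi0 : 0 < phi. Proof. by rewrite /phi !mulr_gt0 //; lia. Qed.
Let dl0 : 0 < dl. Proof. by rewrite /dl !mulr_gt0 ?exprn_gt0 //; lia. Qed.
Let phi3 : (x ^+ 3 - 1) * phi <= x * y.
Proof.
have -> : (x ^+ 3 - 1) * phi = x * ((x ^+ 3 - 1) * (x - 1) * p) by rewrite /phi; ring.
by rewrite ler_pM2l //; lia.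
Qed.
Let phi1 : (x - 1) * phi <= y.
Proof.
apply: le_trans yp; rewrite -subr_ge0.
have -> : (x ^+ 3 - 1) * (x - 1) * p - (x - 1) * phi =
   (x ^+ 2 + 1) * ((x - 1) * (x - 1) * p) by rewrite /phi; ring.
apply: mulr_ge0; first by rewrite addr_ge0 ?exprn_ge0; lia.
by rewrite !mulr_ge0; lia.
Qed.

Let phi2 : (x ^+ 2 - 1) * phi <= (x + 1) * y.
Proof.
have -> : (x ^+ 2 - 1) * phi = (x + 1) * ((x - 1) * phi) by ring.
by rewrite ler_pM2l //; lia.
Qed.
Let xy0 : 0 < x * y. Proof. by rewrite mulr_gt0 //; lia. Qed.
Let xk0 k : 0 < x ^+ k. Proof. by rewrite exprn_gt0 //; lia. Qed.

Let x21 : 0 < x ^+ 2 + 1. Proof. by have := xk0 2; lia. Qed.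
Let c0 : 0 < c. Proof. by rewrite /c mulr_gt0 //; lia. Qed.

(** The multiples of [y] follow the orbit [c, c + 1, - c, - c - 1] of the first leader, where [- c]
    is [c + x + 1]; the deviation [x ^+ i * phi] is bounded by [phi1], [phi2] and [phi3]. *)
Lemma balanced_start i : (i < 4)%N -> balanced n D (D * x ^+ i).
Proof.
have f1 := mulr_gt0 (xk0 1) phi0; have f2 := mulr_gt0 (xk0 2) phi0.
have f3 := mulr_gt0 (xk0 3) phi0; have g1 := phi1; have g2 := phi2; have g3 := phi3.
rewrite expr1 in f1; rewrite !mulrBl in g1 g2 g3; case: i => [|[|[|[|]]]] // _.
- exists D, 0; split; first by ring.
  rewrite n_c /D; lia.
- exists ((c + 1) * y - x * phi), (h - 1); split.
    by rewrite /D /c nE xE; ring.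
  rewrite n_c /D; lia.
- exists ((c + x + 1) * y - x ^+ 2 * phi), (x * (h - 1) + h - 1); split.
    by rewrite /D /c nE xE; ring.
  rewrite n_c /D; lia.
exists ((c + x) * y - x ^+ 3 * phi), (x * (x * (h - 1) + h - 1) + h); split.
  by rewrite /D /c nE xE; ring.
rewrite n_c /D; lia.
Qed.

(** Because [x ^+ 4 * phi = 2c (y + x ^+ 2 - 1)], four steps lead from near [c * y] to near
    [- c * y], with deviation only [dl]. Each further block of four fixes the multiple of [y] and
    multiplies the deviation by [x ^+ 4]. *)
Lemma orbit_four j : exists z, D * x ^+ (4 + 4 * j) = (c + x + 1) * y - x ^+ (4 * j) * dl + n * z.
Proof.
elim: j => [|j [z IH]].
  exists (x ^+ 2 * (x * (h - 1) + h - 1) + x * h + (h - 1)); rewrite muln0 addn0 expr0.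
  have E : x ^+ 4 * phi = x * (x - 1) * (y + x ^+ 2 - 1) by rewrite /phi yE; ring.
  have -> : D * x ^+ 4 = c * y * x ^+ 4 - x ^+ 4 * phi by rewrite /D; ring.
  by rewrite E /dl /c nE xE; ring.
exists (z * x ^+ 4 + (c + x + 1) * (x ^+ 2 - 1)).
have -> : (4 + 4 * j.+1 = 4 + 4 * j + 4)%N by lia.
rewrite exprD mulrA IH; have -> : (4 * j.+1 = 4 * j + 4)%N by lia.
by rewrite exprD nE; ring.
Qed.

Let x1 : 0 <= x - 1. Proof. by lia. Qed.
Let xge1 : 1 <= x. Proof. by lia. Qed.
Let xgt0 : 0 < x. Proof. by lia. Qed.

Let Ydl Y : 0 < Y -> (x ^+ 2 + 1) * p = x ^+ 2 * Y + 1 -> Y * dl <= y.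
Proof.
move=> Y0 pE; rewrite -subr_ge0 -(pmulr_rge0 _ x21).
have -> : (x ^+ 2 + 1) * (y - Y * dl) = Y * (x * (x ^+ 4 + (x - 1))) + 1.
  have -> : (x ^+ 2 + 1) * (y - Y * dl) =
      x ^+ 4 * ((x ^+ 2 + 1) * p) - (x ^+ 4 - 1) - (x ^+ 2 + 1) * Y * dl.
    by rewrite yE; ring.
  by rewrite pE /dl; ring.
apply: addr_ge0 => //; apply: mulr_ge0; first exact: ltW.
by apply: mulr_ge0; [exact: le_trans x2 | apply: addr_ge0 => //; exact: ltW (xk0 4)].
Qed.

Let Yphi Y : 0 < Y -> (x ^+ 2 + 1) * p = x ^+ 2 * Y + 1 -> Y * dl <= x ^+ 2 * phi.
Proof.
move=> Y0 pE; rewrite -subr_ge0 -(pmulr_rge0 _ x21).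
have -> : (x ^+ 2 + 1) * (x ^+ 2 * phi - Y * dl) = x * (x - 1) * (x ^+ 2 + Y).
  have -> : (x ^+ 2 + 1) * (x ^+ 2 * phi - Y * dl) =
      x ^+ 3 * (x - 1) * ((x ^+ 2 + 1) * p) - (x ^+ 2 + 1) * Y * dl.
    by rewrite /phi; ring.
  by rewrite pE /dl; ring.
apply: mulr_ge0; first by apply: mulr_ge0 => //; exact: le_trans x2.
by apply: addr_ge0; apply: ltW; rewrite ?xk0.
Qed.

(** [Y] stands for [q ^ (4t)]. Exponents below [m = 4t + 6] with [i >= 2] have [j < t], which leaves
    room for the extra factor [x ^+ 4]. *)
Lemma balanced_late j i (Y : int) : (i < 4)%N -> 0 < Y -> (x ^+ 2 + 1) * p = x ^+ 2 * Y + 1 ->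
  x ^+ (4 * j) * (if (i < 2)%N then 1 else x ^+ 4) <= Y ->
  balanced n D (D * x ^+ (4 + 4 * j + i)).
Proof.
move=> i4 Y0 pE hX; have [z hz] := orbit_four j.
have h1 := Ydl Y0 pE; have h2 := Yphi Y0 pE.
have X0 := xk0 (4 * j).
rewrite exprD mulrA hz {hz pE}; move: (x ^+ (4 * j)) X0 hX => X X0.
have Xdl0 : 0 < X * dl by rewrite mulr_gt0.
have f1 := mulr_gt0 (xk0 1) Xdl0; have f2 := mulr_gt0 (xk0 2) Xdl0.
have f3 := mulr_gt0 (xk0 3) Xdl0; rewrite expr1 in f1.
case: i i4 => [|[|[|[|]]]] //= _ hX.
- have XY : X * dl <= Y * dl by rewrite ler_pM2r // -[X]mulr1.
  exists ((c + x + 1) * y - X * dl), z; split; first by ring.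
  have XY1 := le_trans XY h1; move: XY1 Xdl0 xy0 phi0 y0; rewrite n_c /D !mulrDl mul1r.
  move: (c * y) (x * y) phi (X * dl) => cy xy ph u e1 e2 e3 e4 e5.
  clear -e1 e2 e3 e4 e5; lia.
- have XY : x * (X * dl) <= x * y.
    by rewrite ler_pM2l //; apply: le_trans h1; rewrite ler_pM2r // -[X]mulr1.
  exists ((c + x) * y - x * (X * dl)), (z * x + h); split.
    by rewrite /c nE xE; ring.
  move: XY f1 xy0 phi0 y0; rewrite n_c /D !mulrDl mul1r.
  move: (c * y) (x * y) phi (x * (X * dl)) => cy xy ph u e1 e2 e3 e4 e5.
  clear -e1 e2 e3 e4 e5; lia.
(* The tight case: the residue falls below [c * y], by at most the [phi] that separates [D] from
   it. *)
- have XY : x ^+ 2 * (X * dl) <= phi.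
    rewrite -(ler_pM2l (xk0 2)); apply: le_trans h2.
    have -> : x ^+ 2 * (x ^+ 2 * (X * dl)) = X * x ^+ 4 * dl by ring.
    by rewrite ler_pM2r.
  exists (c * y - x ^+ 2 * (X * dl)), (z * x ^+ 2 + h * x + h); split.
    by rewrite /c nE xE; ring.
  move: XY f2 xy0 phi0 y0; rewrite n_c /D !mulrDl mul1r.
  move: (c * y) (x * y) phi (x ^+ 2 * (X * dl)) => cy xy ph u e1 e2 e3 e4 e5.
  clear -e1 e2 e3 e4 e5; lia.
have XY : x ^+ 3 * (X * dl) <= y.
  apply: le_trans h1; have -> : x ^+ 3 * (X * dl) = X * x ^+ 3 * dl by ring.
  rewrite ler_pM2r //; apply: le_trans hX.
  by rewrite ler_pM2l // (exprS x 3) ler_peMl // ltW // xk0.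
exists ((c + 1) * y - x ^+ 3 * (X * dl)), (z * x ^+ 3 + h * x ^+ 2 + h * x + h - 1); split.
  by rewrite /c nE xE; ring.
move: XY f3 xy0 phi0 y0; rewrite n_c /D !mulrDl mul1r.
  move: (c * y) (x * y) phi (x ^+ 3 * (X * dl)) => cy xy ph u e1 e2 e3 e4 e5.
  clear -e1 e2 e3 e4 e5; lia.
Qed.
End Balanced.

Local Open Scope nat_scope.

Lemma balanced_modn (n d a : nat) : 0 < d -> balanced n%:Z d%:Z a%:Z ->
  d <= a %% n <= n - d.
Proof.
move=> d0 [r [z [Ea /andP [dr rn]]]].
have n0 : 0 < n by lia.
have an := ltn_pmod a n0; have := congr1 Posz (divn_eq a n).
rewrite PoszD PoszM Ea => E.
have E' : ((a %% n)%N%:Z - r = n%:Z * (z - (a %/ n)%N%:Z))%R by lia.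
have b1 : (`|(a %% n)%N%:Z - r| < n%:Z)%R by lia.
suff Er : ((a %% n)%N%:Z = r)%R by lia.
move: b1; rewrite E' normrM.
case: (eqVneq (z - (a %/ n)%N%:Z)%R 0%R) => [e0|ne0]; first by move: E'; rewrite e0 mulr0; lia.
have : (n%:Z * 1 <= n%:Z * `|z - (a %/ n)%N%:Z|)%R by rewrite ler_wpM2l //; lia.
lia.
Qed.

Lemma second_leader_gt0 h t : 0 < h -> 0 < second_leader h t.
Proof.
move=> h0; have := quotS_double t h0; rewrite -subn_gt0 => N0.
by rewrite /second_leader !muln_gt0 h0 N0 andbT; lia.
Qed.

Lemma second_leader_leader h t n q m : 0 < h -> q = 2 * h -> m = 4 * t.+1 + 2 ->
  n = q ^ m + 1 -> is_coset_leader n q (second_leader h t).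
Proof.
move=> h0 qE mE nE; have q1 : 1 < q by lia.
have m0 : 0 < m by lia.
have om := ord_mod_2m nE q1 m0.
have d0 := second_leader_gt0 t h0.
have PN := ltnW (quotS_double t h0); rewrite -qE in PN.
have PN3 := quotS_bound t h0; rewrite -qE in PN3.
have Ex : (q%:Z = 2 * h%:Z)%R by rewrite qE PoszM.
have En : (n%:Z = (q%:Z ^+ 2 + 1) * (quot q t.+1)%:Z)%R.
  by rewrite nE mE -quotE PoszM PoszD PoszX.
have EN : ((quot q t.+1)%:Z = q%:Z ^+ 4 * (quot q t)%:Z - q%:Z ^+ 2 + 1)%R.
  have := congr1 Posz (quotS q t); rewrite !PoszD PoszM !PoszX => E.
  by apply: (addIr (q%:Z ^+ 2)%R); rewrite E; ring.
have EP : ((q%:Z ^+ 2 + 1) * (quot q t)%:Z = q%:Z ^+ 2 * q%:Z ^+ (4 * t) + 1)%R.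
  by rewrite -exprD -!PoszX -PoszD -PoszM quotE PoszD addnC.
have Ep : (q.-1%:Z = q%:Z - 1)%R by lia.
have ED : ((second_leader h t)%:Z = h%:Z * (q%:Z - 1) * (quot q t.+1)%:Z -
    q%:Z * (q%:Z - 1) * (quot q t)%:Z)%R.
  by rewrite /second_leader -qE !PoszM Ep -subzn // PoszM Ex; ring.
have E3 : ((q%:Z ^+ 3 - 1) * (q%:Z - 1) * (quot q t)%:Z <= (quot q t.+1)%:Z)%R.
  rewrite -Ep -PoszX (_ : (q ^ 3)%:Z - 1 = (q ^ 3).-1%:Z)%R; last first.
    have : 0 < q ^ 3 by rewrite expn_gt0 (ltnW q1).
    lia.
  by rewrite -!PoszM.
have h0' : (0 < h%:Z)%R by lia.
have y0 : (0 < (quot q t.+1)%:Z)%R by have := quot_gt0 q t.+1; lia.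
have p0 : (0 < (quot q t)%:Z)%R by have := quot_gt0 q t; lia.
have bal i : i < m -> second_leader h t <= second_leader h t * q ^ i %% n <= n - second_leader h t.
  move=> im; apply: balanced_modn => //; rewrite PoszM PoszX ED.
  have [i4|i4] := ltnP i 4; first exact: (balanced_start h0' Ex y0 p0 EN En E3 i4).
  have -> : i = 4 + 4 * ((i - 4) %/ 4) + (i - 4) %% 4.
    by rewrite -addnA [4 * _]mulnC -divn_eq subnKC.
  apply: (@balanced_late _ _ _ _ _ h0' Ex y0 p0 EN En E3 _ _ (q%:Z ^+ (4 * t))%R) => //.
  - by rewrite ltn_mod.
  - by rewrite exprn_gt0 //; lia.
  case: ifP => r2.
    by rewrite mulr1 ler_eXn2l; lia.
  by rewrite -exprD ler_eXn2l; lia.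
have mod_lt : second_leader h t < n.
  by have := bal 0 m0; rewrite expn0 muln1; have := @ltn_pmod (second_leader h t) n; lia.
apply/coset_leaderP; split=> // x /mapP [i]; rewrite mem_iota om add0n /= => im ->.
have [i_m|m_i] := ltnP i m; first by case/andP: (bal i i_m).
(* The second half of the coset is the negative of the first. *)
have im' : i - m < m by lia.
have /andP [b1 b2] := bal _ im'.
rewrite -(subnK m_i) expnD mulnA (modn_mul_negative nE) ?(leq_trans d0 b1) //.
move: (second_leader h t) (_ %% n) mod_lt b2 => d a dn an; lia.
Qed.

Lemma second_lt_first h t : 0 < h -> second_leader h t < first_leader h t.+1.
Proof.
move=> h0; have := quotS_double t h0; have := quot_gt0 (2 * h) t => P0 PN.
by rewrite /second_leader /first_leader ltn_pmul2l ?muln_gt0 ?h0; lia.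
Qed.

Lemma delta_first_second h t n q m : 0 < h -> q = 2 * h -> m = 4 * t.+1 + 2 -> n = q ^ m + 1 ->
  delta_i n q 1 = first_leader h t.+1 /\ delta_i n q 2 = second_leader h t.
Proof.
move=> h0 qE mE nE; have q1 : 1 < q by lia.
have m0 : 0 < m by lia.
have n1 : 1 < n by rewrite nE addn1 ltnS expn_gt0 (ltnW q1).
have qr1 : q ^ ord_mod n q %% n = 1 by rewrite (ord_mod_2m nE) // expn_2m_mod.
have l1 := first_leader_leader h0 qE mE nE.
have l2 := second_leader_leader h0 qE mE nE.
have l12 := second_lt_first t h0; have l20 := second_leader_gt0 t h0.
have above s : is_coset_leader n q s -> second_leader h t < s -> s = first_leader h t.+1.
  move=> ls hs; apply/esym/(@coset_leader_uniq n q) => //.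
  exact: meets_first_leader qE mE h0 nE ls hs.
have d1 : delta_i n q 1 = first_leader h t.+1.
  have ge1 : first_leader h t.+1 <= delta_i n q 1.
    rewrite leqNgt; apply/negP => lt; by have [] := delta_i_gt l1 lt.
  apply: above; first by apply: delta_i_leader; lia.
  lia.
split=> //; have ge2 : second_leader h t <= delta_i n q 2.
  rewrite leqNgt; apply/negP => /(delta_i_gt l2) [[|//] _]; lia.
apply/eqP; rewrite eqn_leq ge2 andbT leqNgt; apply/negP => gt2.
have d2 : delta_i n q 2 = delta_i n q 1.
  by rewrite d1; apply: above => //; apply: delta_i_leader; lia.
by have := @delta_i_inj n q 1 0; rewrite d2 d1 => /(_ (ltn_trans l20 l12) erefl).
Qed.

(** The positivity conditions cover degenerate lists: for [q = 2] and [m = 2] the only leaders are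
    [1] and [0]. *)
Lemma card_coset_delta h t n q m : 0 < h -> q = 2 * h -> m = 4 * t + 2 -> n = q ^ m + 1 ->
  (0 < delta_i n q 1 -> #|coset_set n q (delta_i n q 1)| = 4) /\
  (0 < delta_i n q 2 -> #|coset_set n q (delta_i n q 2)| = 2 * m).
Proof.
move=> h0 qE mE nE; case: t mE => [|t] mE.
  have m2 : m = 2 by lia.
  rewrite m2 in nE *; have lt i : 0 < delta_i n q i -> 0 < delta_i n q i < n.
    by move=> d0; rewrite d0; case/andP: (delta_i_leader d0).
  by split=> /lt; exact: (card_coset_sqr_succ h0 qE nE).
have [-> ->] := delta_first_second h0 qE mE nE.
by split=> _; [apply: card_first_leader h0 qE mE nE | apply: card_second_leader h0 qE mE nE].
Qed.

(** The leaders outside the range are the [k] largest ones, and also [0] when [b = 1]; its coset of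
    size 1 gives the summand [b]. *)
Lemma BCH_dim_delta (F : finFieldType) (L : fieldExtType F) (beta : L) n m k b d delta h t :
  0 < h -> #|F| = 2 * h -> m = 4 * t + 2 -> n = #|F| ^ m + 1 ->
  (n.-primitive_root beta)%R -> b <= 1 -> b + d.-1 = delta -> 0 < k ->
  delta_i n #|F| k.+1 < delta <= delta_i n #|F| k ->
  code_dim (BCH_code n beta d b) =
    b + \sum_(i < k) #|coset_set n #|F| (delta_i n #|F| i.+1)|.
Proof.
set q := #|F| => h0 qE mE nE prim b1 bd k0 /andP [dk kd]; have q1 : 1 < q by lia.
have m0 : 0 < m by lia.
have n1 : 1 < n by rewrite nE addn1 ltnS expn_gt0 (ltnW q1).
have qr1 : q ^ ord_mod n q %% n = 1 by rewrite (ord_mod_2m nE) // expn_2m_mod.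
have dpos : 0 < delta by exact: leq_ltn_trans dk.
pose ls := [seq delta_i n q i.+1 | i <- iota 0 k].
have ls_ge s : s \in ls -> is_coset_leader n q s /\ delta <= s.
  move=> /mapP [i]; rewrite mem_iota add0n /= => ik ->.
  have di : delta <= delta_i n q i.+1.
    by apply: leq_trans kd _; rewrite -(prednK k0); apply: delta_i_anti; lia.
  by split=> //; apply: delta_i_leader; apply: leq_trans di.
have ls_in s : is_coset_leader n q s -> (s \in ls) = (delta <= s).
  move=> lead; apply/idP/idP => [/ls_ge []|ds] //.
  have [j jk ->] := delta_i_gt lead (leq_trans dk ds).
  by apply/mapP; exists j; rewrite // mem_iota.
have uls : uniq ls.
  rewrite map_inj_in_uniq ?iota_uniq // => i j; rewrite !mem_iota !add0n /= => ik jk.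
  apply: delta_i_inj; apply: leq_trans dpos _.
  by have [] := ls_ge (delta_i n q i.+1) (map_f _ _) => //; rewrite mem_iota.
have dn : delta < n.
  have [] := ls_ge (delta_i n q k) => [|/andP [kn _] dlk]; last exact: leq_ltn_trans kn.
  by apply/mapP; exists k.-1; rewrite ?mem_iota ?prednK //; lia.
have sumls : \sum_(s <- ls) #|coset_set n q s| =
    \sum_(i < k) #|coset_set n q (delta_i n q i.+1)|.
  by rewrite big_map -[X in iota 0 X]subn0 -/(index_iota 0 k) big_mkord.
have all_ls : all (is_coset_leader n q) ls by apply/allP => s /ls_ge [].
rewrite -sumls; case: b b1 bd => [|[|//]] _ bd.
  rewrite add0n; apply: BCH_dim_leaders => //; rewrite ?bd ?(ltnW dn) //.
  by move=> s lead; rewrite ls_in // -/q leqNgt.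
transitivity (\sum_(s <- 0 :: ls) #|coset_set n q s|); last first.
  by rewrite big_cons card_coset_set0.
apply: BCH_dim_leaders => //; rewrite ?bd ?(ltnW dn) -/q //.
- by rewrite /= uls andbT; apply/negP => /ls_ge [_]; rewrite leqNgt dpos.
- by rewrite /= leader0.
move=> s lead; rewrite inE ls_in //.
by case: s lead => [|s] lead; rewrite //= -leqNgt.
Qed.

(** * The theorem *)

Local Open Scope ring_scope.

Lemma BCH_distance1 (F : finFieldType) (L : fieldExtType F) n (beta : L) delta (c : 'rV[F]_n) :
  n.-primitive_root beta -> c \in BCH_code n beta delta 1 -> c != 0 ->
  (delta <= wt c)%N.
Proof.
move=> prim /in_BCH_code hc cn0; case: delta hc => // delta hc.
by apply: (BCH_bound (a := 1) prim cn0) => l ld; apply: hc.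
Qed.

(** Inversion adds the negative exponents, so the [2 * delta - 1] consecutive exponents from
    [- (delta - 1)] to [delta - 1] are all zeros. *)
Lemma BCH_distance0 (F : finFieldType) (L : fieldExtType F) n (beta : L) m delta (c : 'rV[F]_n) :
  n.-primitive_root beta -> n = (#|F| ^ m + 1)%N -> (delta <= n)%N ->
  c \in BCH_code n beta delta.+1 0 -> c != 0 -> (2 * delta <= wt c)%N.
Proof.
move=> prim nE; case: delta => [|d] dn /in_BCH_code hc cn0; first by rewrite muln0.
have -> : (2 * d.+1 = (2 * d + 1).+1)%N by lia.
(* The start [n - d] represents the exponent [- d], where [d] is [delta - 1]. *)
apply: (BCH_bound (a := n - d) prim cn0) => l ld.
have [ld'|dl] := ltnP l d; last first.
  have -> : (n - d + l = l - d + n)%N by lia.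
  rewrite exprD (prim_expr_order prim) mulr1; apply: hc => /=; lia.
have -> : beta ^+ (n - d + l) = (beta ^+ (d - l)) ^+ (#|F| ^ m).
  rewrite -exprM; apply/eqP; rewrite (eq_prim_root_expr prim).
  rewrite -(eqn_modDl (d - l)) -mulnS -addn1 -nE modnMl.
  by rewrite (_ : d - l + (n - d + l) = n)%N ?modnn //; lia.
rewrite word_horner_frobeniusX hc; last by lia.
rewrite expr0n expn_eq0 -[#|F| == 0%N]negbK -lt0n.
by rewrite (ltnW (finNzRing_gt1 _)).
Qed.

Theorem theorem1 (F : finFieldType) (L : fieldExtType F) (t : nat) (alpha : L) :
  let q := #|F| in
  let m := (4 * t + 2)%N in
  let n := (q ^ m + 1)%N in
  (exists e : nat, q = 2 ^ e)%N ->
  \dim {: L} = ord_mod n q ->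
  alpha != 0 ->
  (forall x : L, x != 0 -> exists k : nat, x = alpha ^+ k) ->
  let beta := alpha ^+ ((q ^ ord_mod n q).-1 %/ n) in
  [/\ (forall delta : nat, (delta_i n q 2 < delta <= delta_i n q 1)%N ->
         is_LCD (BCH_code n beta delta 1) /\
         has_params (BCH_code n beta delta 1) 5 (delta_i n q 2)),
      (forall delta : nat, (delta_i n q 3 < delta <= delta_i n q 2)%N ->
         is_LCD (BCH_code n beta delta 1) /\
         has_params (BCH_code n beta delta 1) (2 * m + 5) (delta_i n q 3)),
      (forall delta : nat, (delta_i n q 2 < delta <= delta_i n q 1)%N ->
         is_LCD (BCH_code n beta delta.+1 0) /\
         has_params (BCH_code n beta delta.+1 0) 4 (2 * delta_i n q 2)) &
      (forall delta : nat, (delta_i n q 3 < delta <= delta_i n q 2)%N ->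
         is_LCD (BCH_code n beta delta.+1 0) /\
         has_params (BCH_code n beta delta.+1 0) (2 * m + 4) (2 * delta_i n q 3))].
Proof.
move=> q m n [e qe] dimL a0 gen beta.
have q1 : (1 < q)%N by apply: finNzRing_gt1.
have [h h0 qE] : exists2 h, (0 < h)%N & q = (2 * h)%N.
  by case: e qe => [|e] qe; [rewrite qe in q1 | exists (2 ^ e)%N; rewrite ?expn_gt0 // qe expnS].
have m0 : (0 < m)%N by rewrite /m addn2.
have om : ord_mod n q = (2 * m)%N by apply: ord_mod_2m.
have prim : n.-primitive_root beta.
  have := generator_prim_root a0 gen; rewrite dimL => primA.
  rewrite /beta -/q; apply: (dvdn_prim_root primA); rewrite -/q om.
  have -> : ((q ^ (2 * m)).-1 = (q ^ m).-1 * n)%N.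
    by rewrite mulnC expnM sqr_pred ?expn_gt0 ?(ltnW q1) // addn1.
  by rewrite dvdn_mull.
have [c1 c2] := @card_coset_delta h t n q m h0 qE erefl erefl.
have LCD d b : is_LCD (BCH_code n beta d b) by apply: (BCH_LCD (m := m)).
have dimP := BCH_dim_delta h0 qE (erefl m) (erefl n) prim.
have dist1 delta D (c : 'rV[F]_n) : (D < delta)%N ->
    c \in BCH_code n beta delta 1 -> c != 0 -> (D <= wt c)%N.
  by move=> Dd cC cn0; apply: leq_trans (ltnW Dd) (BCH_distance1 prim cC cn0).
have dist0 delta D k (c : 'rV[F]_n) : (D < delta <= delta_i n q k)%N ->
    c \in BCH_code n beta delta.+1 0 -> c != 0 -> (2 * D <= wt c)%N.
  move=> /andP [Dd dk] cC cn0; have dn : (delta <= n)%N.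
    have /andP [kn _] := delta_i_leader (leq_trans (leq_ltn_trans (leq0n _) Dd) dk).
    exact: leq_trans dk (ltnW kn).
  by apply: leq_trans (BCH_distance0 prim (erefl n) dn cC cn0); rewrite leq_mul2l ltnW.
have card1 delta : (delta_i n q 2 < delta <= delta_i n q 1)%N ->
    (\sum_(i < 1) #|coset_set n q (delta_i n q i.+1)| = 4)%N.
  move=> /andP [lo hi]; rewrite big_ord1 c1 //.
  exact: leq_trans (leq_ltn_trans _ lo) hi.
have card2 delta : (delta_i n q 3 < delta <= delta_i n q 2)%N ->
    (\sum_(i < 2) #|coset_set n q (delta_i n q i.+1)| = 2 * m + 4)%N.
  move=> /andP [lo hi]; have d2 := leq_trans (leq_ltn_trans (leq0n _) lo) hi.
  have d1 := leq_trans d2 (@delta_i_anti n q 0 1 isT).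
  by rewrite big_ord_recr big_ord1 /= c1 // c2 // addnC.
split=> delta /[dup] range /andP [lo hi]; (split; [exact: LCD | split]).
- by rewrite (dimP 1 1 delta delta) ?(card1 _ range) // add1n prednK // (leq_ltn_trans _ lo).
- by move=> c; apply: dist1.
- rewrite (dimP 2 1 delta delta) ?(card2 _ range) //; first by rewrite add1n -addnS.
  by rewrite add1n prednK // (leq_ltn_trans _ lo).
- by move=> c; apply: dist1.
- by rewrite (dimP 1 0 delta.+1 delta) ?(card1 _ range).
- by move=> c; apply: dist0 range.
- by rewrite (dimP 2 0 delta.+1 delta) ?(card2 _ range).
- by move=> c; apply: dist0 range.
Qed.
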